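(* Let $K$ be a field of characteristic zero and let $B$ be a strongly stable ideal in $S=K[x_1,\dots,x_l]$ such that $S/B$ is Cohen-Macaulay of codimension $2$. Let $\beta_{0,j}$ be the number of minimal generators of $B$ of degree $j$, and let $d_{\min}=\min\{j\mid\beta_{0,j}\neq0\}$ and $d_{\max}=\max\{j\mid\beta_{0,j}\neq0\}$. Assume that (1) $\beta_{0,d_{\min}}=l$; (2) $\beta_{0,d_{\min}}>\beta_{0,d_{\min}+1}\ge\cdots\ge\beta_{0,d_{\max}}$. Then there exists a free (central) hyperplane arrangement $\mathcal{A}$ in $K^l$ such that $B=\mathrm{rgin}(J(\mathcal{A}))$. In particular, $\mathcal{A}$ has $d_{\min}+1$ hyperplanes.
   Context: A monomial ideal $B\subseteq S=K[x_1,\dots,x_l]$ is strongly stable if for every monomial $t\in B$ and all $i<j$ with $x_j\mid t$, the monomial $x_i t/x_j$ lies in $B$. A central hyperplane arrangement in $K^l$ is a finite set $\mathcal{A}=\{H_1,\dots,H_n\}$ of distinct hyperplanes through the origin; write $H_i=\alpha_i^{-1}(0)$ with $\alpha_i\in S$ a linear form, and $Q(\mathcal{A})=\prod_{i=1}^n\alpha_i$. The Jacobian ideal $J(\mathcal{A})$ is the ideal of $S$ generated by $Q(\mathcal{A})$ and all its partial derivatives. Let $D(\mathcal{A})=\{\delta=\sum_i f_i\partial_{x_i}\mid f_i\in S,\ \delta(\alpha_j)\in\langle\alpha_j\rangle \text{ for all } j\}$; $\mathcal{A}$ is free if $D(\mathcal{A})$ is a free $S$-module. For a homogeneous ideal $I\subseteq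 S$, $\mathrm{rgin}(I)$ is the generic initial ideal of $I$ with respect to the degree reverse lexicographic order with $x_1>x_2>\dots>x_l$: the monomial ideal equal to $\mathrm{LT}(g(I))$ for all $g$ in a nonempty Zariski open subset of $\mathrm{GL}(l,K)$ acting by linear changes of coordinates. *)

(* Defs.v *)
From HB Require Import structures.
From mathcomp Require Import all_boot all_order all_algebra.
From mathcomp Require Import boolp.
From mathcomp Require Import mpoly.

Set Implicit Arguments.
Unset Strict Implicit.
Unset Printing Implicit Defensive.

Import GRing.Theory.
Local Open Scope ring_scope.

(* Subsets of a ring, in particular ideals, are predicates [R -> Prop];
   equality of ideals is pointwise equivalence. *)
Section Ideals.
Context (R : comNzRingType).
Implicit Types (I J P G : R -> Prop) (f g : R) (s : seq R).

Definition sub_ideal I J := forall f, I f -> J f.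
Definition eq_ideal I J := forall f, I f <-> J f.

Definition is_ideal I :=
  [/\ I 0, (forall f g, I f -> I g -> I (f + g)) & (forall f g, I g -> I (f * g))].

Definition ideal_gen G f :=
  exists s : seq (R * R),
    (forall p, p \in s -> G p.2) /\ f = \sum_(p <- s) p.1 * p.2.

Definition prime_ideal P :=
  [/\ is_ideal P, ~ P 1 & (forall f g, P (f * g) -> P f \/ P g)].

Definition maximal_ideal P :=
  [/\ is_ideal P, ~ P 1 &
      (forall J, is_ideal J -> sub_ideal P J -> ~ J 1 -> sub_ideal J P)].

(* Notions for the quotient ring R/I are expressed on R: ideals (resp. primes,
   maximal ideals) of R/I are those of R containing I, and a family of elements
   of R/I is given by representatives in R. *)

(* strictly increasing chain of h + 1 primes of R/I with largest element P/I *)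
Definition prime_chain I P (h : nat) :=
  exists c : nat -> R -> Prop,
    [/\ (forall i, (i <= h)%N -> prime_ideal (c i) /\ sub_ideal I (c i)),
        (forall i, (i < h)%N ->
           sub_ideal (c i) (c i.+1) /\ ~ sub_ideal (c i.+1) (c i)) &
        eq_ideal (c h) P].

(* the height of the prime P/I of R/I is h *)
Definition has_height I P (h : nat) :=
  prime_chain I P h /\ (forall h', prime_chain I P h' -> (h' <= h)%N).

(* the codimension (height) of the ideal I of R, i.e. the minimum of the
   heights of the primes of R containing I, exists and is c *)
Definition has_codim I (c : nat) :=
  (exists P, [/\ prime_ideal P, sub_ideal I P & has_height (eq 0) P c]) /\
  (forall P, prime_ideal P -> sub_ideal I P -> prime_chain (eq 0) P c).

Definition ideal_add_seq I s := ideal_gen (fun g => I g \/ g \in s).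

(* s is a regular sequence on R/I *)
Definition regular_seq I s :=
  (forall k f, (k < size s)%N ->
     ideal_add_seq I (take k s) (s`_k * f) -> ideal_add_seq I (take k s) f) /\
  ~ ideal_add_seq I s 1.

(* depth (P/I, R/I) = d *)
Definition has_depth I P (d : nat) :=
  (exists s, [/\ size s = d, (forall f, f \in s -> P f) & regular_seq I s]) /\
  (forall s, (forall f, f \in s -> P f) -> regular_seq I s -> (size s <= d)%N).

(* R/I is Cohen-Macaulay (for R Noetherian): depth = height for each maximal
   ideal.  By depth (P, A) = depth A_P for maximal P, this is the usual
   condition on the local rings A_P. *)
Definition cohen_macaulay_quot I :=
  forall P, maximal_ideal P -> sub_ideal I P ->
    exists d, has_depth I P d /\ has_height I P d.

(* The submodule D of R^l is free, of finite rank.  Over a Noetherian ring D is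
   finitely generated, so that all its bases are finite. *)
Definition free_submodule l (D : 'rV[R]_l -> Prop) :=
  exists (r : nat) (theta : 'I_r -> 'rV[R]_l),
    (forall i, D (theta i)) /\
    (forall d, D d ->
       exists! c : {ffun 'I_r -> R}, d = \sum_(i < r) c i *: theta i).

End Ideals.

Section Monomials.
Context (K : fieldType) (l : nat).
Local Notation S := {mpoly K[l]}.
Implicit Types (B I M : S -> Prop) (m : 'X_{1..l}).

Definition monomial_ideal B :=
  exists G : 'X_{1..l} -> Prop,
    eq_ideal B (ideal_gen (fun f => exists2 m, G m & f = 'X_[m])).

Definition strongly_stable B :=
  monomial_ideal B /\
  (forall m (i j : 'I_l), B 'X_[m] -> (i < j)%N -> (0 < m j)%N ->
     B 'X_[(m - U_(j) + U_(i))%MM]).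

(* membership of m in the minimal monomial generating set of B *)
Definition min_gen B m :=
  B 'X_[m] /\ (forall m', B 'X_[m'] -> (m' <= m)%MM -> m' = m).

Definition beta0 B (j : nat) : nat :=
  #|[set m : 'X_{1..l < j.+1} | `[< min_gen B m /\ mdeg m = j >]]|.

(* Strict degree reverse lexicographic order with 'X_0 > 'X_1 > ...  The order
   [<%O] that mpoly.v puts on monomials (and that defines [mlead]) is documented
   there as degrevlex but is the degree lexicographic one. *)
Definition degrevlex_lt m1 m2 : bool :=
  (mdeg m1 < mdeg m2)%N ||
  ((mdeg m1 == mdeg m2) &&
   [exists j : 'I_l, (m2 j < m1 j)%N &&
     [forall k : 'I_l, (j < k)%N ==> (m1 k == m2 k)]]).

Definition is_lead_monomial (f : S) m :=
  m \in msupp f /\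
  (forall m', m' \in msupp f -> m' != m -> degrevlex_lt m' m).

Definition initial_ideal I : S -> Prop :=
  ideal_gen (fun t => exists f m, [/\ I f, is_lead_monomial f m & t = 'X_[m]]).

(* g maps x_j to \sum_i g_ij x_i *)
Definition linear_change (g : 'M[K]_l) (f : S) : S :=
  f \mPo [tuple \sum_(i < l) g i j *: 'X_i | j < l].

Definition linear_change_ideal (g : 'M[K]_l) I : S -> Prop :=
  fun h => exists2 f, I f & h = linear_change g f.

Definition zariski_open_GL (U : 'M[K]_l -> Prop) :=
  exists F : {mpoly K[l * l]} -> Prop,
    forall g, U g <->
      g \in unitmx /\ exists2 p, F p & p.@[fun k => mxvec g 0 k] != 0.

(* M = rgin(I) *)
Definition is_rgin I M :=
  exists U : 'M[K]_l -> Prop,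
    [/\ zariski_open_GL U, (exists g, U g) &
        forall g, U g -> eq_ideal M (initial_ideal (linear_change_ideal g I))].

End Monomials.

Section Arrangements.
Context (K : fieldType) (l : nat).
Local Notation S := {mpoly K[l]}.

Definition hyperplane (a : S) (v : 'I_l -> K) : Prop := a.@[v] = 0.

(* A central arrangement of n hyperplanes in K^l, given by linear forms
   defining them; the last field says that the hyperplanes are distinct. *)
Record arrangement (n : nat) := Arrangement {
  arr_form :> 'I_n -> S;
  arr_form_homog : forall i, arr_form i \is 1.-homog;
  arr_form_neq0 : forall i, arr_form i != 0;
  arr_distinct : forall i j, i != j ->
    ~ (forall v, hyperplane (arr_form i) v <-> hyperplane (arr_form j) v)
}.

Context (n : nat) (A : arrangement n).

Definition arr_poly : S := \prod_(i < n) A i.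

Definition jacobian_ideal : S -> Prop :=
  ideal_gen (fun g => g = arr_poly \/ exists i : 'I_l, g = arr_poly^`M(i)).

(* the row vector d stands for the derivation \sum_i d_i (d/dx_i) *)
Definition derivation_apply (d : 'rV[S]_l) (f : S) : S :=
  \sum_(i < l) d 0 i * f^`M(i).

Definition log_derivation (d : 'rV[S]_l) : Prop :=
  forall j, ideal_gen (eq (A j)) (derivation_apply d (A j)).

Definition free_arrangement : Prop := free_submodule log_derivation.

End Arrangements.

(* Main.v *)
(* Codimension 2 and the Cohen-Macaulay condition force B to be generated by
   monomials in x_0 and x_1; by strong stability B is then determined by the
   numbers r_e of its monomials of degree e in these two variables, and the
   hypotheses on beta_0 say that r_e is the Hilbert function produced by
   syzygies of degrees e_1, ..., e_(l-1), the partition conjugate to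
   (l - 1, beta_(0,d+1), beta_(0,d+2), ...), where d = d_min is the sum of the e_i.
   Partition the numbers 0, ..., d - 1 into blocks of sizes e_i.  The arrangement
     Q = x_0 * prod_i P_i,  P_i = prod_(m in block i) (x_i - m x_0)
   is free, with basis the Euler derivation and the P_i d/dx_i, and Euler's
   formula turns P_i dQ/dx_i = (dP_i/dx_i) Q into independent syzygies of
   degree e_i between the partial derivatives of Q.
   Upper bound: these syzygies bound the dimension of J(A) in each degree by that
   of B, for every choice of coordinates.
   Lower bound: on the line x_0 = 1, x_1 = ... = x_(l-1) = X the derivatives of Q
   become explicit polynomials for which there are no further syzygies, so the
   restriction of J(A) has at least r_e distinct degrees in degree e; a Wronskian
   argument in characteristic 0 then shows that after a generic change of
   coordinates the monomials of B in x_0, x_1 are leading monomials. *)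

Require Import Defs.
From HB Require Import structures.
From mathcomp Require Import all_boot all_order all_algebra.
From mathcomp Require Import perm boolp.
From mathcomp Require Import mpoly.
From mathcomp Require Import ring zify.

Set Implicit Arguments.
Unset Strict Implicit.
Unset Printing Implicit Defensive.

Import GRing.Theory.
Local Open Scope ring_scope.

(** Write l = n + 2. Both bounds compare dimensions without defining a Hilbert function: each sets
    up a linear system with more unknowns than equations and feeds it to [underdetermined_solution].
    They meet because both rest on one identity in truncated subtraction: the sum over i of k + 1 -
    e_i, plus r_(d+k), is l (k + 1). Here l (k + 1) counts the coefficients of l forms of degree k
    in two variables, and k + 1 - e_i the multiples of the i-th syzygy among them. In the upper
    bound, each monomial in the other l - 2 variables contributes one copy of the identity, shifted
    in degree. In the lower bound, the identity leaves just enough unknowns to make a combination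
    vanish in every degree that can occur. Translating the line by t ties it to leading monomials:
    coefficients on the plane of x_0, x_1 become Taylor coefficients at t, so one determinant is a
    polynomial in the change of coordinates and, along a curve of such changes, a Wronskian. The
    numbers m differ across all blocks, not only inside each, since all forms except x_0 restrict to
    X - m on the same line. *)

Lemma underdetermined_solution (K : fieldType) (I J : finType) (C : J -> I -> K) :
  (#|I| < #|J|)%N ->
  exists c : J -> K, (exists j, c j != 0) /\ forall i, \sum_j c j * C j i = 0.
Proof.
move=> ltIJ.
pose A : 'M[K]_(#|J|, #|I|) := \matrix_(a, b) C (enum_val a) (enum_val b).
have : kermx A != 0.
  rewrite kermx_eq0 /row_free neq_ltn; apply/orP; left.
  exact: leq_ltn_trans (rank_leq_col A) ltIJ.
case/rowV0Pn=> v /sub_kermxP vA v0.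
exists (fun j => v 0 (enum_rank j)); split.
  apply: contrapT => v_eq0; case/eqP: v0; apply/rowP=> a; rewrite mxE.
  apply/eqP/negPn/negP => va0; apply: v_eq0.
  by exists (enum_val a); rewrite enum_valK.
move=> i; move/rowP/(_ (enum_rank i)): vA; rewrite !mxE => vA.
rewrite -[RHS]vA (reindex_omap enum_val (fun j => Some (enum_rank j))) /=.
  by apply: eq_big => [a|a _]; rewrite ?enum_valK ?eqxx ?mxE ?enum_rankK.
by move=> j _; rewrite enum_rankK.
Qed.

(** * Ideals and regular sequences *)

Section Ideals.
Context (R : comNzRingType).
Implicit Types (I J : R -> Prop) (s : seq R).

Lemma ideal_of_gen (G : R -> Prop) g : G g -> ideal_gen G g.
Proof.
move=> Gg; exists [:: (1, g)]; split; last by rewrite big_seq1 mul1r.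
by move=> p; rewrite inE => /eqP->.
Qed.

Lemma ideal_gen_ideal (G : R -> Prop) : is_ideal (ideal_gen G).
Proof.
split=> [|f g [s [Gs ->]] [t [Gt ->]]|f g [s [Gs ->]]].
- by exists [::]; split=> //; rewrite big_nil.
- exists (s ++ t); split; last by rewrite big_cat.
  by move=> p; rewrite mem_cat => /orP[/Gs|/Gt].
- exists [seq (f * p.1, p.2) | p <- s]; split.
    by move=> q /mapP[p ps ->]; apply: Gs ps.
  by rewrite big_map mulr_sumr; apply: eq_bigr => p _; rewrite mulrA.
Qed.

Lemma ideal_gen_min (G : R -> Prop) I :
  is_ideal I -> (forall g, G g -> I g) -> sub_ideal (ideal_gen G) I.
Proof.
case=> I0 ID IM GI f [s [Gs ->]]; rewrite big_seq.
by elim/big_rec: _ => // p g ps Ig; apply: ID => //; apply/IM/GI/Gs.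
Qed.

Lemma idealB I f g : is_ideal I -> I f -> I g -> I (f - g).
Proof. by case=> _ ID IM If Ig; rewrite -mulN1r; apply: ID => //; apply: IM. Qed.

Lemma ideal_sum I (T : eqType) (r : seq T) (F : T -> R) :
  is_ideal I -> (forall i, i \in r -> I (F i)) -> I (\sum_(i <- r) F i).
Proof.
by case=> I0 ID _ IF; rewrite big_seq; elim/big_rec: _ => // i f ir; apply: ID; apply: IF.
Qed.

Definition ideal_add I x : R -> Prop := fun f => exists c, I (f - c * x).

Definition nonzerodivisor I x := forall f, I (x * f) -> I f.

(** Properness is dropped, and each step enlarges the ideal rather than a prefix of the sequence, so
    that induction on [s] can vary [I]. *)
Fixpoint weakly_regular I s :=
  if s is x :: s' then nonzerodivisor I x /\ weakly_regular (ideal_add I x) s' else True.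

Lemma ideal_add_ideal I x : is_ideal I -> is_ideal (ideal_add I x).
Proof.
case=> I0 ID IM; split.
- by exists 0; rewrite mul0r subr0.
- move=> f g [c Ic] [e Ie]; exists (c + e).
  by rewrite (_ : _ - _ = (f - c * x) + (g - e * x)); [exact: ID | ring].
- move=> f g [c Ic]; exists (f * c).
  by rewrite (_ : _ - _ = f * (g - c * x)); [exact: IM | ring].
Qed.

Lemma sub_ideal_add I x : is_ideal I -> sub_ideal I (ideal_add I x).
Proof. by move=> _ f If; exists 0; rewrite mul0r subr0. Qed.

Lemma ideal_add_mem I x c : is_ideal I -> ideal_add I x (c * x).
Proof. by case=> I0 _ _; exists c; rewrite subrr. Qed.

Lemma eq_ideal_ext I J : eq_ideal I J -> I = J.
Proof. by move=> IJ; apply: funext => f; apply: propext. Qed.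

Lemma ideal_addC I x y : ideal_add (ideal_add I x) y = ideal_add (ideal_add I y) x.
Proof.
by apply: eq_ideal_ext => f; split=> -[c [e h]]; exists e, c; rewrite addrAC.
Qed.

Lemma ideal_add_seq_cons I x s : is_ideal I ->
  ideal_add_seq I (x :: s) = ideal_add_seq (ideal_add I x) s.
Proof.
move=> Ii; apply: eq_ideal_ext => f; split.
- apply: ideal_gen_min => [|g]; first exact: ideal_gen_ideal.
  case=> [Ig|]; first by apply: ideal_of_gen; left; exact: sub_ideal_add.
  rewrite inE => /orP[/eqP->|gs]; last by apply: ideal_of_gen; right.
  by apply: ideal_of_gen; left; have := ideal_add_mem x 1 Ii; rewrite mul1r.
- apply: ideal_gen_min => [|g]; first exact: ideal_gen_ideal.
  have [_ GD GM] := ideal_gen_ideal (fun g => I g \/ g \in x :: s).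
  case=> [[c Ic]|gs]; last by apply: ideal_of_gen; right; rewrite inE gs orbT.
  rewrite -(subrK (c * x) g); apply: GD; first by apply: ideal_of_gen; left.
  by apply/GM/ideal_of_gen; right; rewrite mem_head.
Qed.

Lemma ideal_add_seq_nil I : is_ideal I -> ideal_add_seq I [::] = I.
Proof.
move=> Ii; apply: eq_ideal_ext => f; split=> [|If].
  by apply: ideal_gen_min => // g [].
by apply: ideal_of_gen; left.
Qed.

Lemma regular_seq_weakly I s : is_ideal I -> regular_seq I s -> weakly_regular I s.
Proof.
move=> Ii [reg _]; elim: s I Ii reg => [//|x s IHs] I Ii reg; split.
  by move=> f; have := reg 0%N f isT; rewrite /= ideal_add_seq_nil.
apply: IHs; first exact: ideal_add_ideal.
by move=> k f ks; have /= := reg k.+1 f ks; rewrite ideal_add_seq_cons.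
Qed.

(** If x f = c y modulo I, then y c lies in I + (x), so c = e x modulo I, and cancelling x leaves f
    = e y. Only this half of exchanging x and y holds without a local hypothesis. *)
Lemma nonzerodivisor_swap I x y : is_ideal I -> nonzerodivisor I x ->
  nonzerodivisor (ideal_add I x) y -> nonzerodivisor (ideal_add I y) x.
Proof.
move=> Ii regx regy f [c Ic].
have [e Ie] : ideal_add I x c.
  apply: regy; exists f.
  rewrite (_ : _ - _ = (-1) * (x * f - c * y)); last by ring.
  by case: Ii => _ _; apply.
exists e; apply: regx.
rewrite (_ : _ * _ = (x * f - c * y) + y * (c - e * x)); last by ring.
by case: Ii => _ ID IM; apply: ID => //; apply: IM.
Qed.

Lemma ideal_addX_sub I x N : sub_ideal (ideal_add I (x ^+ N.+1)) (ideal_add I x).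
Proof. by move=> f [c Ic]; exists (c * x ^+ N); rewrite -mulrA -exprSr. Qed.

(** Induction on N: y f = c x^(N+1) forces f = g x modulo I, and cancelling x reduces to y g = c
    x^N. *)
Lemma nonzerodivisor_addX I x y N : is_ideal I -> nonzerodivisor I x ->
  nonzerodivisor (ideal_add I x) y -> nonzerodivisor (ideal_add I (x ^+ N)) y.
Proof.
move=> Ii regx regy; elim: N => [|N IHN] f.
  by move=> _; exists f; rewrite expr0 mulr1 subrr; case: Ii.
case=> c Ic; have [g Ig] : ideal_add I x f.
  by apply: regy; apply: (@ideal_addX_sub _ _ N); exists c.
have [e Ie] : ideal_add I (x ^+ N) g.
  apply: IHN; exists c; apply: regx.
  rewrite (_ : _ * _ = (y * f - c * x ^+ N.+1) - y * (f - g * x)).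
    by apply: idealB => //; case: Ii => _ _; apply.
  by rewrite exprS; ring.
exists e; rewrite (_ : _ - _ = (f - g * x) + x * (g - e * x ^+ N)).
  by case: Ii => _ ID IM; apply: ID => //; apply: IM.
by rewrite exprS; ring.
Qed.

(** Once y is adjoined to I, x is still a nonzerodivisor by [nonzerodivisor_swap], so the induction
    continues with I + (y). *)
Lemma weakly_regular_addX I x s N : is_ideal I -> nonzerodivisor I x ->
  weakly_regular (ideal_add I x) s -> weakly_regular (ideal_add I (x ^+ N)) s.
Proof.
move=> Ii; elim: s I Ii => [//|y s IHs] I Ii regx [regy regs]; split.
  exact: nonzerodivisor_addX.
rewrite ideal_addC; apply: IHs; first exact: ideal_add_ideal.
  exact: nonzerodivisor_swap regx regy.
by rewrite ideal_addC.
Qed.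

End Ideals.

(** * Polynomials in a regular sequence act without torsion *)

Section FaithfulAction.
Context (K : fieldType) (R : comNzRingType) (emb : {rmorphism K -> R}).
Implicit Types (I : R -> Prop) (s : seq R).

(* [nz_eval s f] says that f is the value at s of some nonzero polynomial over
   K in [size s] variables: the variable x is split off as x^r (g + x h) with g
   the value of a nonzero polynomial in the remaining variables. *)
Fixpoint nz_eval s (f : R) : Prop :=
  if s is x :: s' then
    exists r g h, nz_eval s' g /\ f = x ^+ r * (g + x * h)
  else exists2 c, c != 0 & f = emb c.

Lemma nz_evalM s f g : nz_eval s f -> nz_eval s g -> nz_eval s (f * g).
Proof.
elim: s f g => [|x s IHs] f g /=.
  by move=> [c c0 ->] [e e0 ->]; exists (c * e); rewrite ?rmorphM ?mulf_neq0.
move=> [r [f0 [f1 [nf ->]]]] [t [g0 [g1 [ng ->]]]].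
exists (r + t)%N, (f0 * g0), (f0 * g1 + f1 * g0 + x * f1 * g1); split; first exact: IHs.
by rewrite exprD; ring.
Qed.

Lemma nz_evalX s f N : nz_eval s f -> nz_eval s (f ^+ N.+1).
Proof. by elim: N => // N IHN nf; rewrite exprS; apply: nz_evalM => //; apply: IHN. Qed.

Lemma expr_mod_add (g x h : R) N : exists q p, g ^+ N = q * (g + x * h) + p * x ^+ N.
Proof.
elim: N => [|N [q [p E]]]; first by exists 0, 1; rewrite mul0r add0r mul1r.
exists (g * q + p * x ^+ N), (- p * h); rewrite exprS E exprS; ring.
Qed.

(* If (g + x h) u is in I then g^N u is in I + x^N, as g + x h divides g^N modulo
   x^N; the remaining sequence is still regular modulo I + x^N. *)
Lemma nz_eval_torsion (m : nat -> R -> Prop) :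
  (forall N x, m 1%N x -> m N (x ^+ N)) ->
  (forall N f g, m N f -> m N g -> m N (f + g)) ->
  (forall N f g, m N g -> m N (f * g)) -> (forall N, m N 0) ->
  forall s I u f, is_ideal I -> weakly_regular I s -> (forall x, x \in s -> m 1%N x) ->
  nz_eval s f -> I (f * u) -> forall N, exists2 w, I w & m N (u - w).
Proof.
(* [m N] stands for the N-th power of a maximal ideal; the conclusion puts u in I + m^N for every
   N. *)
move=> mX mD mM m0; elim=> [|x s IHs] I u f Ii.
  move=> _ _ [c c0 ->] Iu N; exists u; last by rewrite subrr.
  rewrite -[u]mul1r -(rmorph1 emb) -(mulVf c0) rmorphM -mulrA.
  by case: Ii => _ _; apply.
move=> [regx regs] sm [r [g [h [ng ->]]]] Iu N.
have {Iu} Iu : I ((g + x * h) * u).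
  elim: r Iu => [|r IHr]; first by rewrite mul1r.
  by rewrite exprS -!mulrA => /regx; rewrite mulrA; apply: IHr.
(* [nz_evalX] gives positive exponents, hence g^(N+1); the remainder p x^(N+1) is still a multiple
   of x^N. *)
have [q [p E]] := expr_mod_add g x h N.+1.
have sm' y : y \in s -> m 1%N y by move=> ys; apply: sm; rewrite inE ys orbT.
have [|w [c Iw] mw] := IHs (ideal_add I (x ^+ N)) u (g ^+ N.+1) (ideal_add_ideal _ Ii)
  (weakly_regular_addX N Ii regx regs) sm' (nz_evalX N ng) _ N.
  exists (p * x * u); rewrite E exprS.
  rewrite (_ : _ - _ = q * ((g + x * h) * u)); last by ring.
  by case: Ii => _ _; apply.
exists (w - c * x ^+ N) => //.
rewrite (_ : _ - _ = (u - w) + c * x ^+ N); last by ring.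
by apply: mD => //; apply/mM/mX/sm; rewrite mem_head.
Qed.

End FaithfulAction.

Section KillVariables.
Context (K : fieldType) (l : nat).
Local Notation S := {mpoly K[l]}.

Definition kill (k : nat) : S -> S :=
  comp_mpoly [tuple if (i < k)%N then 0 else 'X_i | i < l].
HB.instance Definition _ k := GRing.RMorphism.copy (kill k) (kill k).
HB.instance Definition _ k := GRing.Linear.copy (kill k) (kill k).

Definition avoids k (m : 'X_{1..l}) := [forall i : 'I_l, (i < k)%N ==> (m i == 0%N)].

Lemma avoidsP k (m : 'X_{1..l}) : reflect (forall i : 'I_l, (i < k)%N -> m i = 0%N) (avoids k m).
Proof.
apply: (iffP forallP) => h i; first by move=> ik; apply/eqP; have := h i; rewrite ik.
by apply/implyP => ik; rewrite h.
Qed.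

Lemma killX k m : kill k 'X_[m] = if avoids k m then 'X_[m] else 0.
Proof.
rewrite /kill comp_mpolyX; case: avoidsP => [h|h].
  rewrite [RHS]mpolyXE_id; apply: eq_bigr => i _; rewrite tnth_mktuple.
  by case: ifP => // /h ->; rewrite !expr0.
have [i ik mi] : exists2 i : 'I_l, (i < k)%N & m i != 0%N.
  apply: contrapT => nex; apply: h => i ik; apply/eqP/negPn/negP => mi.
  by apply: nex; exists i.
by rewrite (bigD1 i) //= tnth_mktuple ik expr0n (negPf mi) mul0r.
Qed.

Lemma mcoeff_kill k f m : (kill k f)@_m = if avoids k m then f@_m else 0.
Proof.
rewrite {1}[f]mpolyE rmorph_sum raddf_sum /=.
under eq_bigr => n _ do rewrite linearZ /= killX mcoeffZ.
rewrite [f in RHS]mpolyE raddf_sum /=.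
case: ifP => am; last first.
  apply: big1 => n _; case: ifP => an; last by rewrite mcoeff0 mulr0.
  by rewrite mcoeffX; case: eqP => [En|_]; [by rewrite -En an in am | rewrite mulr0].
apply: eq_bigr => n _; rewrite mcoeffZ; case: ifP => // an.
by rewrite mcoeff0 mcoeffX; case: eqP => // En; rewrite En am in an.
Qed.

Lemma msupp_kill k f m : m \in msupp (kill k f) -> avoids k m /\ m \in msupp f.
Proof. by rewrite !mcoeff_msupp mcoeff_kill; case: ifP => // _; rewrite eqxx. Qed.

End KillVariables.

(** * Algebraic dependence by counting power products *)

Section AlgebraicDependence.
Context (K : fieldType) (R : comNzRingType) (emb : {rmorphism K -> R}).

Fixpoint exponents N d : seq (seq nat) :=
  if d is d'.+1 then [seq i :: es | i <- iota 0 N, es <- exponents N d'] else [:: [::]].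

Fixpoint power_product (s : seq R) (es : seq nat) : R :=
  match s, es with
  | x :: s', i :: es' => x ^+ i * power_product s' es'
  | _, _ => 1
  end.

Lemma size_exponents N d : size (exponents N d) = (N ^ d)%N.
Proof. by elim: d => //= d IHd; rewrite size_allpairs size_iota IHd expnS. Qed.

Lemma uniq_exponents N d : uniq (exponents N d).
Proof.
elim: d => //= d IHd; apply: allpairs_uniq => //; first exact: iota_uniq.
by move=> [i es] [j es'] _ _ /= [-> ->].
Qed.

Lemma sum_expr_split (x : R) (G : nat -> R) r N : (r < N)%N ->
  (forall i, (i < r)%N -> G i = 0) ->
  exists h, \sum_(i <- iota 0 N) x ^+ i * G i = x ^+ r * (G r + x * h).
Proof.
move=> rN G0; exists (\sum_(r.+1 <= i < N) x ^+ (i - r.+1) * G i).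
rewrite -[N in iota 0 N]subn0 -/(index_iota 0 N).
rewrite (big_cat_nat (leq0n r) (ltnW rN)) /= big_nat big1 ?add0r; last first.
  by move=> i /andP[_ /G0 ->]; rewrite mulr0.
rewrite big_ltn //= mulrDr; congr (_ + _).
rewrite mulrA -exprSr mulr_sumr; apply: eq_big_nat => i /andP[ri _].
by rewrite mulrA -exprD subnKC.
Qed.

(** The exponent r in [nz_eval] is the least power of x that carries a nonzero coefficient; the part
    at x^r is then a nonzero polynomial in the remaining elements. *)
Lemma nz_eval_comb N s (c : seq nat -> K) :
  (exists2 es, es \in exponents N (size s) & c es != 0) ->
  nz_eval emb s (\sum_(es <- exponents N (size s)) emb (c es) * power_product s es).
Proof.
elim: s c => [|x s IHs] c /=.
  by move=> [es]; rewrite inE => /eqP-> c0; exists (c [::]); rewrite ?big_seq1 ?mulr1.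
move=> [_ /allpairsP[[i es] [/= iN es_in ->] ci0]].
pose P i := `[< exists2 es, es \in exponents N (size s) & c (i :: es) != 0 >].
have exP : exists i, P i by exists i; apply/asboolP; exists es.
case: (ex_minnP exP) => r /asboolP Pr minr.
have rN : (r < N)%N.
  apply: leq_ltn_trans (minr i _) _; first by apply/asboolP; exists es.
  by rewrite mem_iota in iN.
pose G i := \sum_(es <- exponents N (size s)) emb (c (i :: es)) * power_product s es.
have [|h E] := @sum_expr_split x G r N rN.
  move=> j jr; rewrite /G big_seq big1 // => es' es'_in.
  suff /eqP-> : c (j :: es') == 0 by rewrite rmorph0 mul0r.
  apply/negPn/negP => cj; move: jr; rewrite ltnNge minr //.
  by apply/asboolP; exists es'.
exists r, (G r), h; split; first exact: IHs.
rewrite -E big_allpairs_dep /=; apply: eq_bigr => j _.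
by rewrite /G mulr_sumr; apply: eq_bigr => es' _; rewrite mulrCA.
Qed.

End AlgebraicDependence.

Section MpolyDependence.
Context (K : fieldType) (l : nat).
Local Notation S := {mpoly K[l]}.

Lemma msizeM_leq (p q : S) a b :
  (msize p <= a.+1)%N -> (msize q <= b.+1)%N -> (msize (p * q) <= (a + b).+1)%N.
Proof.
have [->|p0] := eqVneq p 0; first by rewrite mul0r msize0.
have [->|q0] := eqVneq q 0; first by rewrite mulr0 msize0.
rewrite msizeM //; move: (msize p) (msize q) => u v hu hv; lia.
Qed.

Lemma msize_power_product (s : seq S) D N es :
  (forall x, x \in s -> (msize x <= D.+1)%N) -> es \in exponents N (size s) ->
  (msize (power_product s es) <= (size s * (N * D)).+1)%N.
Proof.
elim: s es => [|x s IHs] es /= sD; first by rewrite msize1.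
case/allpairsP => -[i es'] [/= iN es'_in ->].
rewrite mulSn; apply: msizeM_leq; last first.
  by apply: IHs => // y ys; apply: sD; rewrite inE ys orbT.
have xD : (msize (x ^+ i) <= (i * D).+1)%N.
  elim: i {iN} => [|i IHi]; first by rewrite expr0 msize1.
  by rewrite exprS mulSn; apply: msizeM_leq => //; apply: sD; rewrite mem_head.
apply: leq_trans xD _; rewrite ltnS leq_mul2r; apply/orP; right.
by rewrite mem_iota in iN; lia.
Qed.

(* More elements than surviving variables: among the N^d products of powers with
   exponents < N, the images lie in a space of dimension O(N^(l-k)). *)
Lemma exists_dependence k (s : seq S) : (l - k < size s)%N ->
  exists2 f, nz_eval (mpolyC l (R := K)) s f & kill k f = 0.
Proof.
set d := size s => lkd.
pose D := \max_(x <- s) msize x.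
have sD x : x \in s -> (msize x <= D.+1)%N.
  by move=> xs; apply: leqW; exact: (@leq_bigmax_seq _ s xpredT (fun x : S => msize x)).
(* There are N^d unknowns and at most (N (dD + 1))^(l-k) equations. As d > l - k, it is enough that
   N exceed (dD + 1)^(l-k). *)
pose N := ((d * D).+1 ^ (l - k)).+1.
pose M := (d * (N * D))%N.
pose T := {i : 'I_l | (k <= i)%N}.
have cardT : #|{: T}| = (l - k)%N.
  rewrite card_sig -sum1_card; transitivity (\sum_(k <= i < l) 1)%N.
    by rewrite big_geq_mkord.
  by rewrite sum_nat_const_nat muln1.
pose mon (phi : {ffun T -> 'I_M.+1}) : 'X_{1..l} :=
  [multinom if insub i is Some j then phi j : nat else 0%N | i < l].
pose E := exponents N d.
pose C (j : 'I_(size E)) (phi : {ffun T -> 'I_M.+1}) :=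
  (kill k (power_product s (nth [::] E j)))@_(mon phi).
have [|c [[j cj] sol]] := underdetermined_solution C.
  rewrite card_ffun !card_ord cardT size_exponents.
  apply: (@leq_ltn_trans ((N * (d * D).+1) ^ (l - k))).
    have MN : (M.+1 <= N * (d * D).+1)%N by rewrite /M mulnCA mulnS -[_.+1]add1n leq_add2r.
    by case: (posnP (l - k)) => [->|lk0]; rewrite ?expn0 // leq_exp2r.
  rewrite expnMn; apply: (@leq_trans (N ^ (l - k).+1)).
    rewrite expnSr ltn_mul2l expn_gt0 /=.
    by rewrite /N ltnS.
  by rewrite leq_exp2l // /N ltnS expn_gt0.
pose c' es := if insub (index es E) is Some j then c j else 0.
have c'E (i : 'I_(size E)) : c' (nth [::] E i) = c i.
  by rewrite /c' index_uniq ?uniq_exponents // valK.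
exists (\sum_(es <- E) (c' es)%:MP * power_product s es).
  by apply: nz_eval_comb; exists (nth [::] E j); rewrite ?mem_nth // c'E.
apply/mpolyP => m; rewrite mcoeff0 rmorph_sum raddf_sum /=.
under eq_bigr => es _ do rewrite rmorphM /= {1}/kill comp_mpolyC mcoeffCM.
case: (pselect (exists phi, m = mon phi)) => [[phi ->]|nmon].
  rewrite (big_nth [::]) big_mkord -[RHS](sol phi).
  by apply: eq_bigr => i _; rewrite c'E.
rewrite big_seq big1 // => es es_in; apply/eqP; rewrite mulf_eq0; apply/orP; right.
rewrite mcoeff_eq0; apply/negP => /msupp_kill[/avoidsP am m_in].
apply: nmon; exists [ffun t : T => inord (m (val t))].
apply/mnmP => i; rewrite mnmE; case: insubP => [t _ <-|]; last by rewrite -ltnNge; apply: am.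
rewrite ffunE inordK // ltnS.
rewrite -ltnS; apply: leq_trans (msize_power_product sD es_in).
by apply: leq_ltn_trans (msize_mdeg_lt m_in); rewrite mdegE (bigD1 (val t)) //= leq_addr.
Qed.

End MpolyDependence.

(** * Strongly stable Cohen-Macaulay ideals of codimension two *)

Section CoordinatePrimes.
Context (K : fieldType) (l : nat).
Local Notation S := {mpoly K[l]}.
Implicit Types (B I P : S -> Prop) (m : 'X_{1..l}).

Definition coord_prime k : S -> Prop := fun f => kill k f = 0.

Lemma coord_primeP k f : coord_prime k f <-> (forall m, avoids k m -> f@_m = 0).
Proof.
split=> [kf0 m am|h]; last first.
  by apply/mpolyP => m; rewrite mcoeff0 mcoeff_kill; case: ifP => // /h.
by move/mpolyP/(_ m): kf0; rewrite mcoeff0 mcoeff_kill am.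
Qed.

Lemma coord_prime_prime k : prime_ideal (coord_prime k).
Proof.
split.
- split; first exact: rmorph0.
  + by move=> f g; rewrite /coord_prime rmorphD /= => -> ->; rewrite addr0.
  + by move=> f g; rewrite /coord_prime rmorphM /= => ->; rewrite mulr0.
- by rewrite /coord_prime rmorph1 => /eqP; rewrite oner_eq0.
- move=> f g; rewrite /coord_prime rmorphM => /eqP.
  by rewrite mulf_eq0 => /orP[/eqP|/eqP]; [left | right].
Qed.

Lemma coord_primeS k k' : (k <= k')%N -> sub_ideal (coord_prime k) (coord_prime k').
Proof.
move=> kk' f /coord_primeP h; apply/coord_primeP => m /avoidsP am; apply: h.
by apply/avoidsP => i ik; apply: am; apply: leq_trans kk'.
Qed.

Lemma avoidsU k (i : 'I_l) c : (k <= i)%N -> avoids k (U_(i) *+ c)%MM.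
Proof.
move=> ki; apply/avoidsP => j jk; rewrite mulmnE mnm1E.
by case: eqP => // E; move: jk; rewrite -E ltnNge ki.
Qed.

Lemma coord_primeX k (i : 'I_l) : coord_prime k 'X_i <-> (i < k)%N.
Proof.
rewrite /coord_prime killX; case: ifP => [/avoidsP am|na].
  split=> [/eqP|/am]; last by rewrite mnm1E eqxx.
  by rewrite -msize_poly_eq0 msizeX.
by split=> // _; rewrite ltnNge; apply/negP => /(avoidsU 1); rewrite mulm1n na.
Qed.

Lemma coord_prime_strict k : (k < l)%N ->
  ~ sub_ideal (coord_prime k.+1) (coord_prime k).
Proof.
move=> kl /(_ 'X_(Ordinal kl)); rewrite !coord_primeX /= ltnn.
by move/(_ (leqnn _)).
Qed.

Lemma coord_prime_min k I : is_ideal I -> (forall i : 'I_l, (i < k)%N -> I 'X_i) ->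
  sub_ideal (coord_prime k) I.
Proof.
move=> Ii IX f /coord_primeP h; rewrite [f]mpolyE; apply: ideal_sum => // m mf.
have : ~~ avoids k m by apply/negP => /h /eqP; rewrite mcoeff_eq0 mf.
rewrite negb_forall => /existsP[i]; rewrite negb_imply => /andP[ik mi].
rewrite -mul_mpolyC; case: (Ii) => _ _ IM; apply/IM.
rewrite -[m](@submK _ U_(i)%MM) ?lep1mP // mpolyXD; apply: IM.
exact: IX.
Qed.

Lemma prime_chain_coord I P k : prime_ideal P -> sub_ideal I (coord_prime 0) ->
  (k <= l)%N -> sub_ideal (coord_prime k) P ->
  exists2 h, (k <= h)%N & prime_chain I P h.
Proof.
move=> Pp Ik kl kP.
have IP i : sub_ideal I (coord_prime i) by move=> f /Ik; apply: coord_primeS.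
have [Pk|nPk] := pselect (sub_ideal P (coord_prime k)).
  exists k; first by [].
  exists coord_prime; split.
  - by move=> i _; split; [apply: coord_prime_prime | apply: IP].
  - move=> i ik; split; first exact: coord_primeS.
    by apply: coord_prime_strict; apply: leq_trans kl.
  - by move=> f; split; [apply: kP | apply: Pk].
exists k.+1; first by [].
exists (fun i => if (i <= k)%N then coord_prime i else P); split.
- move=> i _; case: ifP => _; split; [exact: coord_prime_prime | exact: IP | exact: Pp |].
  by move=> f /(IP k) /kP.
- move=> i; rewrite ltnS => ik; rewrite ik; case: ltnP => ik'.
    split; first exact: coord_primeS.
    by apply: coord_prime_strict; apply: leq_trans kl.
  by have -> : i = k by lia.
- by rewrite ltnn.
Qed.

Lemma coord_prime_maximal : maximal_ideal (coord_prime l).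
Proof.
have [Pi P1 _] := coord_prime_prime l; split=> // J Ji PJ J1 f Jf.
have E : kill l f = (f@_0)%:MP.
  apply/mpolyP => m; rewrite mcoeff_kill mcoeffC; case: avoidsP => [am|nam].
    suff -> : m = 0%MM by rewrite eqxx mulr1.
    by apply/mnmP => i; rewrite mnm0E am.
  by case: eqP => [m0|]; rewrite ?mulr0 //; case: nam => i _; rewrite m0 mnm0E.
rewrite /coord_prime E; have [-> //|f0] := eqVneq (f@_0) 0; case: J1.
have Jc : J (f@_0)%:MP.
  rewrite -(subKr f (f@_0)%:MP); apply: idealB => //; apply: PJ.
  by rewrite /coord_prime rmorphB /= E /kill comp_mpolyC subrr.
rewrite -mpolyC1 -(mulVf f0) mpolyCM.
by case: Ji => _ _; apply.
Qed.

Lemma monomial_ideal_ideal B : monomial_ideal B -> is_ideal B.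
Proof. by case=> G /eq_ideal_ext ->; apply: ideal_gen_ideal. Qed.

Lemma monomial_ideal_msupp B f m : monomial_ideal B -> B f -> m \in msupp f -> B 'X_[m].
Proof.
move=> Bm; have [_ _ BM] := monomial_ideal_ideal Bm.
case: (Bm) => G EG /EG[s [Gs ->]].
move/msupp_sum_le/flattenP => [r /mapP[p]]; rewrite filter_predT => ps -> mp.
have [n Gn E] := Gs p ps.
have Bn : B 'X_[n] by apply/EG/ideal_of_gen; exists n.
move: mp; rewrite E (perm_mem (msuppMX _ _)) => /mapP[m' _ ->].
by rewrite addmC mpolyXD; apply: BM.
Qed.

Lemma monomial_ideal_min B I : monomial_ideal B -> is_ideal I ->
  (forall m, B 'X_[m] -> I 'X_[m]) -> sub_ideal B I.
Proof.
move=> Bm Ii BI f Bf; rewrite [f]mpolyE; apply: ideal_sum => // m mf.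
rewrite -mul_mpolyC; case: (Ii) => _ _ IM; apply/IM/BI.
exact: monomial_ideal_msupp Bf mf.
Qed.

Lemma monomial_ideal_le B m m' : monomial_ideal B -> B 'X_[m] -> (m <= m')%MM -> B 'X_[m'].
Proof.
move=> Bm Bx mm'; rewrite -(submK mm') mpolyXD.
by case: (monomial_ideal_ideal Bm) => _ _; apply.
Qed.

(** Every variable of m after x_k is exchanged for x_k, one at a time; [mdeg m - m k] counts the
    exchanges left. *)
Lemma strongly_stable_power B (k : 'I_l) m : strongly_stable B -> avoids k m ->
  B 'X_[m] -> B 'X_[U_(k) *+ mdeg m].
Proof.
move=> [Bm Bs]; move: {2}(mdeg m - m k)%N (erefl (mdeg m - m k)%N) => n.
elim: n m => [|n IHn] m E /avoidsP am Bx.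
  suff -> : (U_(k) *+ mdeg m = m)%MM by [].
  apply/mnmP => i; rewrite mulmnE mnm1E; case: eqP => [<-|ki] /=.
    rewrite mul1n; apply/eqP; rewrite eqn_leq mdegE (bigD1 k) //= leq_addr andbT.
    by move: E; rewrite mdegE (bigD1 k) //=; lia.
  move: E; rewrite mul0n mdegE (bigD1 k) //= (bigD1 i) //=; last by apply/eqP => /esym.
  lia.
have [j kj mj] : exists2 j : 'I_l, (k < j)%N & (0 < m j)%N.
  apply: contrapT => nex; move: E; rewrite mdegE (bigD1 k) //= big1 ?addn0 ?subnn // => i ik.
  case: (ltngtP i k) => [/am //|ki|/val_inj/eqP]; last by rewrite (negPf ik).
  by apply/eqP; rewrite -leqn0 leqNgt; apply/negP => mi; apply: nex; exists i.
set m' := (m - U_(j) + U_(k))%MM.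
have Em : mdeg m' = mdeg m.
  rewrite mdegD mdeg1 -[in RHS](@submK _ U_(j)%MM m) ?mdegD ?mdeg1 //.
  by rewrite lep1mP -lt0n.
rewrite -Em; apply: IHn; last exact: Bs.
  rewrite Em /m' mnmDE mnmBE !mnm1E eqxx.
  by rewrite (_ : (j == k) = false) ?subn0 ?addn1; [lia | apply/eqP => jk; rewrite jk ltnn in kj].
apply/avoidsP => i ik; rewrite mnmDE mnmBE !mnm1E am // sub0n.
by case: eqP => // ki; rewrite ki ltnn in ik.
Qed.

End CoordinatePrimes.

Section CohenMacaulayCodim2.
Context (K : fieldType).

(** In a chain 0 < P < (x_0), each f in P is a multiple of x_0, and since x_0 is not in P the
    quotient lies in P again. Descent on the degree gives P = 0. *)
Lemma height_one_coord_prime l :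
  ~ prime_chain (eq (0 : {mpoly K[l]})) (coord_prime 1) 2.
Proof.
move=> [c [cp cS c2]].
have [[[[c10 _ cM] _ cprime] _] [c12 nc21]] := (cp 1%N isT, cS 1%N isT).
have [_ nc10] := cS 0%N isT.
have c0 : c 0%N 0 by case: (cp 0%N isT) => -[[]].
have c1P f : c 1%N f -> coord_prime 1 f by move=> /c12 /c2.
(* An index i < 1 stands for x_0 and keeps l = 0 in scope. *)
pose I (f : {mpoly K[l]}) := exists i : 'I_l, exists2 g, (i < 1)%N & f = g * 'X_i.
have divX f : coord_prime 1 f -> f = 0 \/ I f.
  pose J f := f = 0 \/ I f.
  apply: (@coord_prime_min _ _ _ J) => [|i i0]; last first.
    by right; exists i, 1; rewrite ?mul1r.
  split; first by left.
    move=> g h [->|[i [g' i0 ->]]]; first by rewrite add0r.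
    move=> [->|[j [h' j0 ->]]]; first by rewrite addr0; right; exists i, g'.
    have -> : j = i by apply/val_inj => /=; lia.
    by right; exists i, (g' + h'); rewrite // mulrDl.
  move=> g h [->|[i [h' i0 ->]]]; first by left; rewrite mulr0.
  by right; exists i, (g * h'); rewrite // mulrA.
have nX (i : 'I_l) : (i < 1)%N -> ~ c 1%N 'X_i.
  move=> i0 ci; apply: nc21 => f /c2; apply: coord_prime_min.
    by case: (cp 1%N isT) => -[].
  by move=> j j0; have -> : j = i by apply/val_inj => /=; lia.
apply: nc10 => f c1f; suff -> : f = 0 by [].
move: {2}(msize f) (leqnn (msize f)) c1f => n.
elim: n f => [|n IHn] f; first by rewrite leqn0 msize_poly_eq0 => /eqP.
move=> sf c1f; case: (divX f (c1P f c1f)) => // -[i [g i0 E]].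
suff g0 : g = 0 by rewrite E g0 mul0r.
have [//|g0] := eqVneq g 0; apply: IHn.
  move: sf; rewrite E msizeM // -?msize_poly_eq0 ?msizeX // mdeg1.
  by rewrite addn2.
by move: c1f; rewrite E => /cprime[|/nX] // /(_ i0).
Qed.

(** If B were inside (x_0), codimension 2 would give a chain of length 2 below (x_0). So B has a
    monomial free of x_0, and stability turns it into powers of x_0 and x_1. *)
Lemma codim2_powers l (B : {mpoly K[l]} -> Prop) : strongly_stable B -> has_codim B 2 ->
  (1 < l)%N /\ exists b, forall i : 'I_l, (i < 2)%N -> B 'X_[U_(i) *+ b].
Proof.
move=> Bs [[P [Pp BP _]] Bch]; have [Bm _] := Bs.
have nB1 : ~ B 1 by move=> /BP; case: Pp.
have [m am Bx] : exists2 m, avoids 1 m & B 'X_[m].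
  apply: contrapT => nex; apply: (@height_one_coord_prime l); apply: Bch.
    exact: coord_prime_prime.
  apply: monomial_ideal_min => //; first by case: (coord_prime_prime K l 1).
  move=> m Bx; apply/coord_primeP => n an; rewrite mcoeffX; case: eqP => // E.
  by exfalso; apply: nex; exists m => //; rewrite E.
have l1 : (1 < l)%N.
  rewrite ltnNge; apply/negP => l1; apply: nB1; rewrite -mpolyX0.
  suff <- : m = 0%MM by [].
  apply/mnmP => i; rewrite mnm0E; move/avoidsP: am; apply.
  by apply: leq_trans l1.
split=> //; exists (mdeg m) => i; case: i => -[|[|//]] lt_l _; last first.
  by apply: strongly_stable_power => //.
apply: (@strongly_stable_power _ _ _ (Ordinal lt_l)) => //.
by apply/avoidsP.
Qed.

(** A monomial of B free of x_0 and x_1 would put a power of x_2 in B by stability. The prime P of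
    height 2 over B would then contain x_0, x_1, x_2 and have height at least 3. *)
Lemma codim2_sub_coord_prime l (B : {mpoly K[l]} -> Prop) :
  strongly_stable B -> has_codim B 2 -> sub_ideal B (coord_prime 2).
Proof.
move=> Bs Bc; have [[P [Pp BP [_ Ph]]] _] := Bc; have [Bm _] := Bs.
have [l1 [b Bb]] := codim2_powers Bs Bc.
apply: monomial_ideal_min => //; first by case: (coord_prime_prime K l 2).
move=> m Bx; apply/coord_primeP => n an; rewrite mcoeffX; case: eqP => // E.
move: an; rewrite -{}E => am {n}; exfalso.
have [|l2] := leqP l 2.
  move=> l2; have m0 : m = 0%MM.
    by apply/mnmP => i; rewrite mnm0E; move/avoidsP: am; apply; apply: leq_trans l2.
  by case: Pp => _ P1 _; apply/P1/BP; rewrite -mpolyX0 -m0.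
have PX (i : 'I_l) c : P 'X_[U_(i) *+ c] -> P 'X_i.
  case: Pp => _ P1 PM; elim: c => [|c IHc]; first by rewrite mulm0n mpolyX0 => /P1.
  by rewrite mulmS mpolyXD => /PM[].
have P3 (i : 'I_l) : (i < 3)%N -> P 'X_i.
  rewrite ltnS leq_eqVlt => /orP[/eqP i2|i2]; last by apply/PX/BP/Bb.
  by apply: (PX _ (mdeg m)); apply/BP; apply: strongly_stable_power; rewrite // i2.
have [h h3 Ch] : exists2 h, (3 <= h)%N & prime_chain (eq 0) P h.
  apply: prime_chain_coord => //; first by move=> _ <-; rewrite /coord_prime rmorph0.
  by apply: coord_prime_min => //; case: Pp.
by have := leq_trans h3 (Ph h Ch).
Qed.

(** The N-th power of the ideal of all variables, used as the filtration [m] of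
    [nz_eval_torsion]. *)
Definition min_mdeg l N (f : {mpoly K[l]}) := forall m, m \in msupp f -> (N <= mdeg m)%N.

Lemma min_mdegM l M N (f g : {mpoly K[l]}) :
  min_mdeg M f -> min_mdeg N g -> min_mdeg (M + N) (f * g).
Proof.
move=> hf hg m /msuppM_le /allpairsP[[m1 m2] /= [m1f m2g ->]].
by rewrite mdegD leq_add ?hf ?hg.
Qed.

(* Otherwise S/B contains the cyclic module generated by u, killed by x_0, ..., x_k:
   a regular sequence of length >= l - 2 would be algebraically independent modulo
   these k + 1 > 2 variables. *)
Lemma cm_cyclic_socle l (B : {mpoly K[l]} -> Prop) (k : 'I_l) u :
  monomial_ideal B -> sub_ideal B (coord_prime 2) -> cohen_macaulay_quot B -> (1 < k)%N ->
  (forall i : 'I_l, (i <= k)%N -> B ('X_i * 'X_[u])) -> B 'X_[u].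
Proof.
move=> Bm B2 Bcm k1 Bk.
have Bi := monomial_ideal_ideal Bm.
have l2 : (2 <= l)%N by apply: leq_trans (ltn_ord k); apply: ltnW.
have Bl : sub_ideal B (coord_prime l) by move=> f /B2; apply: coord_primeS.
have [d [[[s [sd sP sreg]] _] [_ dmax]]] := Bcm _ (coord_prime_maximal K l) Bl.
(* The primes (x_0, x_1), ..., (x_0, ..., x_(l-1)) all contain B, so they bound the height, and
   hence the depth, from below. *)
have ld : (l - 2 <= d)%N.
  apply: dmax; exists (fun i => coord_prime (2 + i)); split.
  - move=> i _; split; first exact: coord_prime_prime.
    by move=> f /B2; apply: coord_primeS; rewrite leq_addr.
  - move=> i il; rewrite addnS; split; first exact: coord_primeS.
    by apply: coord_prime_strict; rewrite -ltn_subRL.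
  - by rewrite subnKC.
(* As k >= 2, the d >= l - 2 elements outnumber the l - k - 1 variables that survive. *)
have [f nf kf] : exists2 f, nz_eval (mpolyC l (R := K)) s f & kill k.+1 f = 0.
  by apply: exists_dependence; rewrite sd; have := ltn_ord k; lia.
have Bfu : B (f * 'X_[u]).
  move: f kf {nf}; apply: (@coord_prime_min _ _ _ (fun f => B (f * 'X_[u]))); last exact: Bk.
  case: Bi => B0 BD BM; split; first by rewrite mul0r.
    by move=> f g Bf Bg; rewrite mulrDl; apply: BD.
  by move=> f g Bg; rewrite -mulrA; apply: BM.
have [N x mx|N p q mp mq m|N p q mq|N m|x xs|w Bw mw] := nz_eval_torsion (m := @min_mdeg l) _ _ _ _ Bi
  (regular_seq_weakly Bi sreg) _ nf Bfu (mdeg u).+1.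
- elim: N => [|N IHN]; first by move=> m.
  by rewrite exprS -add1n; apply: min_mdegM.
- by move/msuppD_le; rewrite mem_cat => /orP[/mp|/mq].
- by rewrite -[N]add0n; apply: min_mdegM.
- by rewrite msupp0.
- move=> m mx; rewrite lt0n mdeg_eq0; apply/negP => /eqP m0.
  have /coord_primeP/(_ m) := sP _ xs.
  have am : avoids l m by apply/avoidsP => i _; rewrite m0 mnm0E.
  by move/(_ am)/eqP; rewrite mcoeff_eq0 mx.
(* The difference of x^u and w has terms only in degrees above mdeg u, so u occurs in w. *)
- apply: (monomial_ideal_msupp Bm Bw); rewrite mcoeff_msupp.
  suff <- : ('X_[u] : {mpoly K[l]})@_u = w@_u by rewrite mcoeffX eqxx oner_eq0.
  apply/eqP; rewrite -subr_eq0 -mcoeffB mcoeff_eq0; apply/negP => /mw.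
  by rewrite ltnn.
Qed.

Definition first_two n (m : 'X_{1..n.+2}) : 'X_{1..n.+2} :=
  [multinom if (i < 2)%N then m i else 0%N | i < n.+2].

(** Let x_k with k > 1 divide m and let u = m / x_k. Stability puts x_i u in B for all i <= k, so
    [cm_cyclic_socle] gives u itself; repeat until only x_0 and x_1 are left. *)
Lemma cm_codim2_first_two n (B : {mpoly K[n.+2]} -> Prop) m :
  strongly_stable B -> cohen_macaulay_quot B -> has_codim B 2 ->
  B 'X_[m] -> B 'X_[first_two m].
Proof.
move=> Bs Bcm Bc; have [Bm Bst] := Bs.
have B2 := codim2_sub_coord_prime Bs Bc.
move: {2}(mdeg m) (leqnn (mdeg m)) => d; elim: d m => [|d IHd] m.
  rewrite leqn0 mdeg_eq0 => /eqP ->.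
  suff -> : first_two (0%MM : 'X_{1..n.+2}) = 0%MM by [].
  by apply/mnmP => i; rewrite mnmE !mnm0E if_same.
move=> md Bx.
have [[k k1 mk]|nex] := pselect (exists2 k : 'I_n.+2, (1 < k)%N & m k != 0%N); last first.
  suff -> : first_two m = m by [].
  apply/mnmP => i; rewrite mnmE; case: ltnP => // i1.
  by apply/esym/eqP/negPn/negP => mi; apply: nex; exists i.
have km : (U_(k) <= m)%MM by rewrite lep1mP.
have -> : first_two m = first_two (m - U_(k))%MM.
  apply/mnmP => i; rewrite !mnmE; case: ltnP => // i1.
  by case: eqP => [ki|]; rewrite ?subn0 //; move: k1; rewrite ki; lia.
apply: IHd.
  by move: md; rewrite -{1}(submK km) mdegD mdeg1 addn1 ltnS.
apply: (cm_cyclic_socle Bm B2 Bcm k1) => i ik.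
rewrite -mpolyXD addmC; case: (ltngtP i k) ik => // [ik _|/val_inj -> _].
  by apply: Bst => //; rewrite lt0n.
by rewrite submK.
Qed.

End CohenMacaulayCodim2.

(** * Hilbert function in two variables *)

Section TwoVariableMonomials.
Context (K : fieldType) (n : nat) (B : {mpoly K[n.+2]} -> Prop).
Hypothesis Bs : strongly_stable B.
Hypothesis Bft : forall m, B 'X_[m] -> B 'X_[first_two m].

Let Bm : monomial_ideal B := proj1 Bs.

Definition mon2 (i j : nat) : 'X_{1..n.+2} :=
  (U_(ord0) *+ i + U_(lift ord0 ord0) *+ j)%MM.

Lemma mon2_0 i j : mon2 i j ord0 = i.
Proof. by rewrite mnmDE !mulmnE !mnm1E eqxx mul1n mul0n addn0. Qed.

Lemma mon2_1 i j : mon2 i j (lift ord0 ord0) = j.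
Proof. by rewrite mnmDE !mulmnE !mnm1E eqxx mul1n mul0n add0n. Qed.

Lemma mon2_ge2 i j (k : 'I_n.+2) : (1 < k)%N -> mon2 i j k = 0%N.
Proof.
move=> k1; rewrite mnmDE !mulmnE !mnm1E.
by case: eqP => [kE|_]; [rewrite -kE in k1 | case: eqP => [kE|_ //]; rewrite -kE in k1].
Qed.

Lemma mdeg_mon2 i j : mdeg (mon2 i j) = (i + j)%N.
Proof. by rewrite mdegD !mdegMn !mdeg1 !mul1n. Qed.

Lemma mnm_first_two (P : 'I_n.+2 -> Prop) :
  P ord0 -> P (lift ord0 ord0) -> (forall k : 'I_n.+2, (1 < k)%N -> P k) -> forall k, P k.
Proof.
move=> P0 P1 P2 k; case: (ltnP 1 k) => [|k1]; first exact: P2.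
have [->//|k0] := eqVneq k ord0; suff -> : k = lift ord0 ord0 by [].
by apply/val_inj; move: k0; rewrite -val_eqE /= /bump /=; lia.
Qed.

Lemma first_two_mon2 m : first_two m = mon2 (m ord0) (m (lift ord0 ord0)).
Proof.
apply/mnmP; apply: mnm_first_two => [||k k1].
- by rewrite mnmE mon2_0.
- by rewrite mnmE mon2_1.
- by rewrite mnmE mon2_ge2 // ltnNge k1.
Qed.

Lemma mon2_le i j i' j' : (i <= i')%N -> (j <= j')%N -> (mon2 i j <= mon2 i' j')%MM.
Proof.
move=> ii jj; apply/mnm_lepP; apply: mnm_first_two => [||k k1].
- by rewrite !mon2_0.
- by rewrite !mon2_1.
- by rewrite !mon2_ge2.
Qed.

Definition inB i j := `[< B 'X_[mon2 i j] >].

Lemma inB_le i j i' j' : (i <= i')%N -> (j <= j')%N -> inB i j -> inB i' j'.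
Proof.
move=> ii jj /asboolP Bij; apply/asboolP.
exact: monomial_ideal_le Bij (mon2_le ii jj).
Qed.

Lemma inB_shift i j : inB i j.+1 -> inB i.+1 j.
Proof.
move=> /asboolP Bij; apply/asboolP.
have := proj2 Bs _ ord0 (lift ord0 ord0) Bij isT; rewrite mon2_1 => /(_ isT).
set m := (_ - _ + _)%MM; suff -> : m = mon2 i.+1 j by [].
apply/mnmP; apply: mnm_first_two => [||k k1].
- by rewrite mnmDE mnmBE !mnm1E !mon2_0 /=; lia.
- by rewrite mnmDE mnmBE !mnm1E !mon2_1 /=; lia.
- rewrite mnmDE mnmBE !mnm1E !mon2_ge2 // sub0n.
  by case: eqP => // kE; rewrite -kE in k1.
Qed.

(* By strong stability the monomials x_0^(e-j) x_1^j of B are those with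
   j < nrow e. *)
Definition nrow e := find (fun j => ~~ inB (e - j) j) (iota 0 e.+1).

Lemma nrow_le e : (nrow e <= e.+1)%N.
Proof. by rewrite -[X in (_ <= X)%N](size_iota 0 e.+1) find_size. Qed.

Lemma nrowP e j : (j <= e)%N -> inB (e - j) j = (j < nrow e)%N.
Proof.
move=> je; case: ltnP => jr.
  by have /negbFE := before_find 0%N jr; rewrite nth_iota ?add0n.
apply/negbTE/negP => Bj; have re : (nrow e < e.+1)%N by apply: leq_ltn_trans jr _.
have := @nth_find _ 0%N (fun j => ~~ inB (e - j) j) (iota 0 e.+1).
rewrite has_find size_iota -/(nrow e) re => /(_ isT); rewrite nth_iota // add0n => /negP; apply.
have : forall t, (t <= j)%N -> inB (e - (j - t)) (j - t).
  elim=> [|t IHt] tj; first by rewrite subn0.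
  have -> : (e - (j - t.+1) = (e - (j - t)).+1)%N by lia.
  apply: inB_shift; rewrite (_ : (j - t.+1).+1 = j - t)%N; last by lia.
  by apply: IHt; lia.
by move/(_ (j - nrow e)%N (leq_subr _ _)); rewrite subKn.
Qed.

(* The number of those which are multiples of monomials of B of degree e - 1. *)
Definition nrow_multiples e := if e is e'.+1 then (nrow e' + (0 < nrow e'))%N else 0%N.

Lemma nrow_multiples_le e : (nrow_multiples e <= nrow e)%N.
Proof.
case: e => [//|e] /=; case: posnP => [->//|r0]; rewrite addn1.
have re := nrow_le e; rewrite -nrowP ?re //.
apply: (@inB_le (e - (nrow e).-1) (nrow e)); [lia | by []|].
have : inB (e - (nrow e).-1) (nrow e).-1 by rewrite nrowP; lia.
by apply: inB_le; lia.
Qed.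

(** Minimality means that neither quotient, by x_0 or by x_1, lies in B. These quotients sit at
    positions j and j - 1 of degree e - 1, which accounts for the extra 1 in [nrow_multiples]. *)
Lemma min_genP e j : (j <= e)%N ->
  min_gen B (mon2 (e - j) j) <-> (nrow_multiples e <= j < nrow e)%N.
Proof.
move=> je; split=> [[Bj Bmin]|/andP[sj jr]].
  have jr : (j < nrow e)%N by rewrite -nrowP //; apply/asboolP.
  rewrite jr andbT leqNgt; apply/negP => js.
  have noB i' j' : (i' <= e - j)%N -> (j' <= j)%N -> (i' + j' < e)%N -> ~~ inB i' j'.
    move=> ii jj ije; apply/negP => /asboolP/Bmin/(_ (mon2_le ii jj)).
    by move/(congr1 mdeg); rewrite !mdeg_mon2; lia.
  case: e je js jr noB {Bj Bmin} => [|e] je //= js jr noB; have := nrow_le e.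
  case: posnP js => [->//|r0]; rewrite addn1 ltnS leq_eqVlt => /orP[/eqP jE|jr'] re.
    have /negP[] : ~~ inB (e - j.-1) j.-1 by apply: noB; lia.
    by rewrite nrowP; lia.
  have /negP[] : ~~ inB (e - j) j by apply: noB; lia.
  by rewrite nrowP; lia.
split=> [|m' Bm' m'le]; first by apply/asboolP; change (inB (e - j) j); rewrite nrowP.
apply: contrapT => m'neq.
have E : m' = mon2 (m' ord0) (m' (lift ord0 ord0)).
  apply/mnmP; apply: mnm_first_two => [||k k1]; rewrite ?mon2_0 ?mon2_1 ?mon2_ge2 //.
  by apply/eqP; rewrite -leqn0; move/mnm_lepP/(_ k): m'le; rewrite mon2_ge2.
move: E; move: (m' ord0) (m' (lift ord0 ord0)) => i' j' E.
rewrite {m'}E in Bm' m'le m'neq; move: Bm' m'le m'neq => Bij' le' neq.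
have Bij : inB i' j' by apply/asboolP.
have i'e : (i' <= e - j)%N by move/mnm_lepP/(_ ord0): le'; rewrite !mon2_0.
have j'j : (j' <= j)%N by move/mnm_lepP/(_ (lift ord0 ord0)): le'; rewrite !mon2_1.
case: e je sj jr i'e le' neq => [|e] je /=.
  move: je; rewrite leqn0 => /eqP j0; move: j'j; rewrite j0 leqn0 => /eqP-> _ _.
  by rewrite leqn0 => /eqP-> _ [].
move=> sj jr i'e _ neq.
have [i'lt|i'ge] := ltnP i' (e.+1 - j).
  have je' : (j <= e)%N by lia.
  have : inB (e - j) j by apply: inB_le Bij; lia.
  by rewrite nrowP // => jre; move: sj; rewrite (leq_ltn_trans _ jre) //; lia.
have Ei : i' = (e.+1 - j)%N by lia.
have j'lt : (j' < j)%N by rewrite ltn_neqAle j'j andbT; apply/eqP => jE; apply: neq; rewrite Ei jE.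
have : inB (e - j.-1) j.-1 by apply: inB_le Bij; lia.
by rewrite nrowP; [case: posnP sj; lia | lia].
Qed.

Lemma beta0E e : beta0 B e = (nrow e - nrow_multiples e)%N.
Proof.
have fP (j : 'I_e.+1) : (mdeg (mon2 (e - j) j) < e.+1)%N.
  by rewrite mdeg_mon2 subnK -ltnS.
pose f (j : 'I_e.+1) := BMultinom (fP j).
have fE j : f j = mon2 (e - j) j :> 'X_{1..n.+2} by [].
have f_inj : injective f.
  by move=> i j /(congr1 (fun x : 'X_{1..n.+2 < e.+1} => (x : 'X_{1..n.+2}) (lift ord0 ord0)));
     rewrite !fE !mon2_1 => /val_inj.
rewrite /beta0.
have -> : [set m : 'X_{1..n.+2 < e.+1} | `[< min_gen B m /\ mdeg m = e >]] =
          [set f j | j in [set j : 'I_e.+1 | (nrow_multiples e <= j < nrow e)%N]].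
  apply/setP => m; rewrite inE; apply/asboolP/imsetP => [[mg md]|[j]].
    have mE : first_two m = m.
      case: mg => Bx; apply; first exact: Bft.
      by apply/mnm_lepP => i; rewrite mnmE; case: ifP.
    rewrite first_two_mon2 in mE; move: (md); rewrite -mE mdeg_mon2 => md2.
    have je : (m (lift ord0 ord0) < e.+1)%N by lia.
    have mE' : mon2 (e - Ordinal je) (Ordinal je) = m.
      by rewrite -[RHS]mE /=; congr mon2; lia.
    exists (Ordinal je); last by apply/val_inj; exact/esym/mE'.
    by rewrite inE; apply/min_genP => //; rewrite mE'.
  have je : (j <= e)%N by rewrite -ltnS.
  by rewrite inE => jr ->; rewrite fE mdeg_mon2 subnK //; split=> //; apply/min_genP.
rewrite card_imset // cardsE -sum1_card.
transitivity (\sum_(nrow_multiples e <= j < nrow e) 1)%N; last first.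
  by rewrite sum_nat_const_nat muln1.
rewrite big_geq_mkord (big_ord_widen_cond _ (fun i => nrow_multiples e <= i)%N (fun=> 1%N) (nrow_le e)).
by apply: eq_bigl => j; rewrite unfold_in.
Qed.

End TwoVariableMonomials.

(** * Conjugate partitions *)

Section ConjugatePartition.
Context (T : nat) (b : nat -> nat).
Hypothesis b_noninc : forall j, (b j.+1 <= b j)%N.
Hypothesis bT : forall j, (T <= j)%N -> b j = 0%N.

Definition conj_part (i : nat) := (\sum_(j < T) (i < b j))%N.

(** Since b does not increase, the j with i < b j form an initial segment, whose length is
    [conj_part i]. *)
Lemma conj_partP i j : (j < conj_part i)%N = (i < b j)%N.
Proof.
have bmono j1 j2 : (j1 <= j2)%N -> (b j2 <= b j1)%N.
  by move/subnK <-; elim: (j2 - j1)%N => //= t; apply: leq_trans; apply: b_noninc.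
have E t : (\sum_(j < t) (i < b j) <= t)%N.
  by rewrite -[X in (_ <= X)%N]card_ord -sum1_card; apply: leq_sum => a _; case: (_ < _)%N.
have [jT|Tj] := ltnP j T; last first.
  by rewrite bT // ltn0 ltnNge (leq_trans (E T) Tj).
have -> : conj_part i = (\sum_(a < j) (i < b a) + \sum_(a < T - j) (i < b (j + a)))%N.
  rewrite /conj_part; move: (esym (subnKC (ltnW jT))); move: (T - j)%N => t.
  by move: (T) => _ ->; rewrite big_split_ord.
have [ij|ij] := ltnP i (b j).
  rewrite (eq_bigr (fun=> 1%N)) => [|a _].
    rewrite sum1_card card_ord -(ltn_predK (m := 0) (n := T - j)) ?subn_gt0 //.
    by rewrite big_ord_recl addn0 ij /=; lia.
  by rewrite (leq_trans ij) // bmono // ltnW.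
rewrite [X in (_ + X)%N]big1 ?addn0; last first.
  by move=> a _; rewrite ltnNge (leq_trans _ ij) // bmono // leq_addr.
by rewrite ltnNge E.
Qed.

Lemma sum_ltn k c : (\sum_(j < k) (j < c) + (k - c) = k)%N.
Proof.
elim: k => [|k IHk]; first by rewrite big_ord0 sub0n.
rewrite big_ord_recr /=; move: (\sum_(j < k) _)%N IHk => s IHk.
by case: ltnP => kc /=; lia.
Qed.

Context (N : nat).
Hypothesis b0 : (b 0 <= N)%N.

(** Both terms split over i < N: among the k values j < k, those below [conj_part i] are the cells
    counted by b, the others number k - conj_part i. *)
Lemma sum_conj_part k :
  (\sum_(i < N) (k - conj_part i) + \sum_(j < k) b j = N * k)%N.
Proof.
have -> : (\sum_(j < k) b j = \sum_(i < N) \sum_(j < k) (j < conj_part i))%N.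
  rewrite exchange_big; apply: eq_bigr => j _.
  under eq_bigr => i _ do rewrite conj_partP.
  have bN : (b j <= N)%N.
    by apply: leq_trans b0; elim: (val j) => //= t; apply: leq_trans; apply: b_noninc.
  by apply/eqP; rewrite -(eqn_add2r (N - b j)) sum_ltn subnKC.
rewrite -big_split /= (eq_bigr (fun=> k)); last by move=> i _; rewrite addnC sum_ltn.
by rewrite sum_nat_const card_ord.
Qed.

End ConjugatePartition.

Section RowLengths.
Context (K : fieldType) (n : nat) (B : {mpoly K[n.+2]} -> Prop).
Hypothesis Bs : strongly_stable B.
Hypothesis Bft : forall m, B 'X_[m] -> B 'X_[first_two m].
Context (d dmax c : nat).
Hypothesis Bc : forall i : 'I_n.+2, (i < 2)%N -> B 'X_[U_(i) *+ c].
Hypothesis beta_d : beta0 B d = n.+2.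
Hypothesis beta_lt : forall j, beta0 B j <> 0%N -> (d <= j)%N.
Hypothesis beta_max : beta0 B dmax <> 0%N.
Hypothesis beta_gt : forall j, beta0 B j <> 0%N -> (j <= dmax)%N.

Lemma nrowE e : nrow B e = (nrow_multiples B e + beta0 B e)%N.
Proof. by rewrite (beta0E Bs Bft) subnKC // nrow_multiples_le. Qed.

Lemma nrow_lt_d e : (e < d)%N -> nrow B e = 0%N.
Proof.
elim: e => [|e IHe] ed; rewrite nrowE /=; last rewrite IHe ?(ltnW ed) //.
  by rewrite add0n; apply/eqP/negPn/negP => /eqP/beta_lt; rewrite leqNgt ed.
by rewrite add0n; apply/eqP/negPn/negP => /eqP/beta_lt; rewrite leqNgt ed.
Qed.

Lemma nrow_d : nrow B d = n.+2.
Proof.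
by rewrite nrowE beta_d; case: d nrow_lt_d => //= e /(_ e (ltnSn e)) ->.
Qed.

Lemma nrow_gt_d k : nrow B (d + k.+1) = (nrow B (d + k) + 1 + beta0 B (d + k.+1))%N /\ (0 < nrow B (d + k))%N.
Proof.
have E k' : (0 < nrow B (d + k'))%N ->
    nrow B (d + k'.+1) = (nrow B (d + k') + 1 + beta0 B (d + k'.+1))%N.
  by move=> r0; rewrite nrowE addnS /= r0.
have r0 k' : (0 < nrow B (d + k'))%N.
  elim: k' => [|k' IHk']; first by rewrite addn0 nrow_d.
  by rewrite E //; lia.
by split; first exact: E.
Qed.

Lemma beta_gt_dmax j : (dmax < j)%N -> beta0 B j = 0%N.
Proof. by move=> dj; apply/eqP/negPn/negP => /eqP/beta_gt; rewrite leqNgt dj. Qed.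

Lemma le_d_dmax : (d <= dmax)%N.
Proof. exact: beta_lt. Qed.

Lemma nrow_ge_dmax t : nrow B (dmax + t) = (nrow B dmax + t)%N.
Proof.
elim: t => [|t IHt]; first by rewrite !addn0.
rewrite addnS -{1}(subnKC le_d_dmax) -addnA -addnS.
have [-> _] := nrow_gt_d (dmax - d + t).
rewrite addnS addnA subnKC ?le_d_dmax // IHt beta_gt_dmax; lia.
Qed.

(** After [dmax] the rows grow by exactly one per degree, as do the full rows. A power of x_1 in B
    makes some later row full, so the row at [dmax] is already full. *)
Lemma nrow_dmax : nrow B dmax = dmax.+1.
Proof.
have e1 := nrow_le B (dmax + c).
have : inB B 0 (dmax + c).
  apply: (inB_le Bs (leqnn 0) (leq_addl dmax c)).
  apply/asboolP; have := @Bc (lift ord0 ord0) isT.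
  by rewrite /mon2 mulm0n add0m.
have := nrowP Bs (leqnn (dmax + c)); rewrite subnn => ->; rewrite nrow_ge_dmax in e1 *.
by lia.
Qed.

(** The first part is l - 1 and not l because [nrow_sum] separates a growth of one in every degree,
    degree d included. *)
Definition nrow_increment j := if j is 0 then n.+1 else beta0 B (d + j).

Lemma nrow_sum k : nrow B (d + k) = (k.+1 + \sum_(j < k.+1) nrow_increment j)%N.
Proof.
elim: k => [|k IHk]; first by rewrite addn0 nrow_d big_ord1 add1n.
by have [-> _] := nrow_gt_d k; rewrite IHk [in RHS]big_ord_recr /=; lia.
Qed.

Hypothesis beta_d1 : (beta0 B d.+1 < beta0 B d)%N.
Hypothesis beta_noninc : forall j, (d < j)%N -> (j < dmax)%N -> (beta0 B j.+1 <= beta0 B j)%N.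

Lemma exists_exponents : exists e : 'I_n.+1 -> nat,
  (\sum_i e i = d)%N /\
  forall k, (\sum_i (k.+1 - e i) + nrow B (d + k) = n.+2 * k.+1)%N.
Proof.
have b_noninc j : (nrow_increment j.+1 <= nrow_increment j)%N.
  (* The strict inequality between the first two Betti numbers is what gives beta_(d+1) <= l - 1. *)
  case: j => [|j] /=; first by move: beta_d1; rewrite beta_d addn1.
  have [jd|jd] := ltnP (d + j.+1) dmax.
    by rewrite addnS; apply: beta_noninc; rewrite // addnS ltnS leq_addr.
  by rewrite beta_gt_dmax // addnS ltnS.
have b0 : (nrow_increment 0 <= n.+1)%N by [].
have bT j : (dmax.+1 - d <= j)%N -> nrow_increment j = 0%N.
  move=> dj; have := le_d_dmax; case: j dj => [|j] dj dd; first by lia.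
  by apply: beta_gt_dmax; lia.
have E k : (\sum_(i < n.+1) (k.+1 - conj_part (dmax.+1 - d) nrow_increment i) +
    nrow B (d + k) = n.+2 * k.+1)%N.
  by rewrite nrow_sum addnCA (sum_conj_part b_noninc bT b0) mulSn.
exists (conj_part (dmax.+1 - d) nrow_increment); split=> //.
have dd := le_d_dmax.
(* At k = dmax - d no subtraction truncates and the row is full, so the identity determines the sum
   of the e_i. *)
have := E (dmax - d)%N; rewrite subnKC // nrow_dmax.
have eT i : (conj_part (dmax.+1 - d) nrow_increment i <= (dmax - d).+1)%N.
  by rewrite leqNgt (conj_partP b_noninc bT) bT //; lia.
have : (\sum_(i < n.+1) ((dmax - d).+1 - conj_part (dmax.+1 - d) nrow_increment i) +
     \sum_(i < n.+1) conj_part (dmax.+1 - d) nrow_increment i = n.+1 * (dmax - d).+1)%N.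
  rewrite -big_split /= (eq_bigr (fun=> (dmax - d).+1)) ?sum_nat_const ?card_ord //.
  by move=> i _; rewrite subnK.
rewrite (mulSn n.+1); move: (\sum_(i < _) (_ - _))%N (\sum_(i < _) conj_part _ _ _)%N (n.+1 * _)%N.
by move=> x y z; lia.
Qed.

End RowLengths.

(** * The arrangement and its Jacobian ideal *)

Lemma mpoly_ring_ind (R : nzRingType) (l : nat) (P : {mpoly R[l]} -> Prop) :
  (forall c, P c%:MP) -> (forall i, P 'X_i) ->
  (forall f g, P f -> P g -> P (f + g)) -> (forall f g, P f -> P g -> P (f * g)) ->
  forall f, P f.
Proof.
move=> PC PX PD PM f; rewrite [f]mpolyE.
elim/big_rec: _ => [|m g _ Pg]; first by rewrite -mpolyC0.
apply: (PD) => //; rewrite -mul_mpolyC; apply: (PM) => //.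
rewrite mpolyXE_id; elim/big_rec: _ => [|i h _ Ph]; first by rewrite -mpolyC1.
apply: (PM) => //; elim: (m i) => [|k IHk]; first by rewrite expr0 -mpolyC1.
by rewrite exprS; apply: PM.
Qed.

Lemma mderivXU (R : nzRingType) l (i j : 'I_l) :
  ('X_i : {mpoly R[l]})^`M(j) = (i == j)%:R.
Proof.
rewrite mderivX mnm1E; case: eqP => [->|_]; last by rewrite scale0r.
by rewrite -{1}[U_(j)%MM]add0m addmK mpolyX0 scale1r.
Qed.

Lemma ideal_gen_eq (R : comNzRingType) (a f : R) : ideal_gen (eq a) f <-> exists g, f = g * a.
Proof.
split=> [|[g ->]]; last first.
  by case: (ideal_gen_ideal (eq a)) => _ _; apply; apply: ideal_of_gen.
move: f; apply: (@ideal_gen_min _ _ (fun f => exists g, f = g * a)) => [|_ <-]; last first.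
  by exists 1; rewrite mul1r.
split; first by exists 0; rewrite mul0r.
  by move=> _ _ [g ->] [h ->]; exists (g + h); rewrite mulrDl.
by move=> g _ [h ->]; exists (g * h); rewrite mulrA.
Qed.

(** The blocks are encoded as the fibres of a map, so that products over all numbers regroup by
    [partition_big]. *)
Lemma exists_coloring (I : finType) (i0 : I) (e : I -> nat) d : (\sum_i e i = d)%N ->
  exists kap : 'I_d -> I, forall i, #|[pred m | kap m == i]| = e i.
Proof.
move=> sum_e; pose s := flatten [seq nseq (e i) i | i <- enum I].
have size_s : size s = d.
  rewrite size_flatten /shape -map_comp sumnE big_map big_enum /= -sum_e.
  by apply: eq_bigr => i _; rewrite size_nseq.
exists (fun m => nth i0 s m) => i.
have <- : count_mem i s = e i.
  rewrite count_flatten -map_comp sumnE big_map big_enum /= (bigD1 i) //= big1 => [|j ji].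
    by rewrite count_nseq /= eqxx mul1n addn0.
  by rewrite count_nseq /= (negPf ji).
by rewrite -sum1_card -sum1_count (big_nth i0) size_s big_mkord; apply: eq_bigl.
Qed.

Section FreeArrangement.
Context (K : fieldType) (charK : [pchar K] =i pred0) (n d : nat) (kap : 'I_d -> 'I_n.+1).
Local Notation S := {mpoly K[n.+2]}.
Local Notation x0 := ('X_ord0 : S).
Local Notation v := (lift ord0 : 'I_n.+1 -> 'I_n.+2).

Lemma natr_inj0 : injective (fun m => m%:R : K).
Proof.
have nat0 : forall m, (m%:R == 0 :> K) = (m == 0)%N by apply/pcharf0P.
have H a b : (a <= b)%N -> a%:R = b%:R :> K -> a = b.
  move=> ab E; apply/eqP; rewrite eqn_leq ab /= -subn_eq0 -nat0 natrB // E subrr //.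
by move=> a b E; case: (leqP a b) => [|/ltnW] ab; [apply: H | apply/esym/H].
Qed.

Definition lin_form (m : 'I_d) : S := 'X_(v (kap m)) - (m%:R : K) *: x0.

Definition forms (j : 'I_d.+1) : S := oapp lin_form x0 (unlift ord0 j).

Definition block (i : 'I_n.+1) : S := \prod_(m | kap m == i) lin_form m.

Lemma forms0 : forms ord0 = x0.
Proof. by rewrite /forms unlift_none. Qed.

Lemma forms_lift m : forms (lift ord0 m) = lin_form m.
Proof. by rewrite /forms liftK. Qed.

Lemma forms_ind (P : S -> Prop) : P x0 -> (forall m, P (lin_form m)) -> forall j, P (forms j).
Proof. by move=> P0 Pm j; rewrite /forms; case: (unlift ord0 j) => [m|]; [exact: Pm | exact: P0]. Qed.

Lemma homogX i : ('X_i : S) \is 1.-homog.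
Proof. by rewrite dhomogX /= mdeg1. Qed.

Lemma forms_homog j : forms j \is 1.-homog.
Proof.
apply: (forms_ind (P := fun f => f \is 1.-homog)); first exact: homogX.
by move=> m; rewrite rpredB ?rpredZ ?homogX.
Qed.

Lemma forms_neq0 j : forms j != 0.
Proof.
apply: (forms_ind (P := fun f => f != 0)) => [|m].
  by rewrite -msize_poly_eq0 msizeX.
apply/eqP => /(congr1 (mcoeff U_(v (kap m)))).
rewrite mcoeff0 mcoeffB mcoeffZ !mcoeffX eqxx.
have -> : (U_(ord0) == U_(v (kap m)))%MM = false by rewrite eq_mnm1.
by rewrite mulr0 subr0 => /eqP; rewrite oner_eq0.
Qed.

Lemma forms_distinct i j : i != j ->
  ~ (forall w, hyperplane (forms i) w <-> hyperplane (forms j) w).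
Proof.
have val_lin m w : (lin_form m).@[w] = w (v (kap m)) - m%:R * w ord0.
  by rewrite /lin_form mevalB mevalZ !mevalXU.
have H0 m : exists2 w, hyperplane x0 w & ~ hyperplane (lin_form m) w.
  exists (fun i => (i != ord0)%:R); first by rewrite /hyperplane mevalXU eqxx.
  by rewrite /hyperplane val_lin eqxx mulr0 subr0; apply/eqP; rewrite oner_eq0.
move=> ij H; rewrite /forms in H; case: (unliftP ord0 i) ij H => [m ->|->];
  case: (unliftP ord0 j) => [m' ->|->] //=.
(* The point (1, m, ..., m) is a zero of [lin_form m] and of no other [lin_form], whichever blocks
   are involved. *)
- rewrite (inj_eq lift_inj) => mm' /(_ (fun i => if i == ord0 then 1 else m%:R)).
  rewrite /hyperplane !val_lin /= mulr1 subrr mulr1 => -[/(_ erefl)/eqP + _].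
  by rewrite subr_eq0 => /eqP/natr_inj0/val_inj E; rewrite E eqxx in mm'.
- by move=> _ H; case: (H0 m) => w w0 wm; case: wm; apply/H.
- by move=> _ H; case: (H0 m') => w w0 wm; case: wm; apply/H.
Qed.

Definition arr : arrangement K n.+2 d.+1 :=
  Arrangement forms_homog forms_neq0 forms_distinct.

Lemma derivation_applyE w m :
  derivation_apply w (lin_form m) = w 0 (v (kap m)) - (m%:R : K) *: w 0 ord0.
Proof.
rewrite /derivation_apply (bigD1 ord0) //= (bigD1 (v (kap m))) //= big1 ?addr0.
  by rewrite !mderivB !mderivZ !mderivXU !eqxx /= scaler0 subr0 mulr1 sub0r mulrN -scalerAr mulr1 addrC.
move=> i /andP[i0 iv]; rewrite mderivB mderivZ !mderivXU.
by rewrite ![_ == i]eq_sym (negPf i0) (negPf iv) scaler0 subr0 mulr0.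
Qed.

(** Reduction modulo [lin_form m], realised inside S: divisibility becomes vanishing
    ([lin_sub_dvd]), and primality of the form follows as S is a domain. *)
Definition lin_sub (m : 'I_d) : S -> S :=
  comp_mpoly [tuple if j == v (kap m) then (m%:R : K) *: x0 else 'X_j | j < n.+2].
HB.instance Definition _ m := GRing.RMorphism.copy (lin_sub m) (lin_sub m).
HB.instance Definition _ m := GRing.Linear.copy (lin_sub m) (lin_sub m).

Lemma lin_subX m j : lin_sub m 'X_j = if j == v (kap m) then (m%:R : K) *: x0 else 'X_j.
Proof. by rewrite /lin_sub comp_mpolyXU -tnth_nth tnth_mktuple. Qed.

Lemma lin_sub_form m m' : kap m' = kap m ->
  lin_sub m (lin_form m') = (m%:R - m'%:R : K) *: x0.
Proof. by move=> E; rewrite /lin_form linearB linearZ /= !lin_subX E eqxx scalerBl. Qed.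

Lemma lin_sub_dvd m f : lin_sub m f = 0 -> exists g, f = g * lin_form m.
Proof.
suff [g E] : exists g, f - lin_sub m f = g * lin_form m.
  by move=> f0; exists g; rewrite -E f0 subr0.
elim/mpoly_ring_ind: f => [c|j|f g [f' Ef] [g' Eg]|f g [f' Ef] [g' Eg]].
- by exists 0; rewrite /lin_sub comp_mpolyC subrr mul0r.
- rewrite lin_subX; case: eqP => [->|_]; last by exists 0; rewrite subrr mul0r.
  by exists 1; rewrite mul1r.
- by exists (f' + g'); rewrite rmorphD /= mulrDl -Ef -Eg; ring.
- exists (f' * g + lin_sub m f * g'); rewrite rmorphM /=.
  rewrite mulrDl -mulrA [g * _]mulrC mulrA -Ef -mulrA -Eg; ring.
Qed.

(** Modulo one form of the block every other one is a nonzero multiple of x_0, by characteristic 0,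
    so the forms can be divided out one after another. *)
Lemma block_dvd i f : (forall m, kap m = i -> exists g, f = g * lin_form m) ->
  exists h, f = h * block i.
Proof.
rewrite /block -big_filter => df; set s := filter _ _.
have : all (fun m => kap m == i) s by apply: filter_all.
have : uniq s by rewrite filter_uniq ?index_enum_uniq.
elim: s => [|m s IHs] /=; first by exists f; rewrite big_nil mulr1.
move=> /andP[ms us] /andP[/eqP mi si]; have [h fE] := IHs us si.
have [g gE] := df m mi; have : lin_sub m f = 0.
  by rewrite gE rmorphM /= lin_sub_form // subrr scale0r mulr0.
rewrite fE rmorphM rmorph_prod /= => /eqP; rewrite mulf_eq0 => /orP[/eqP h0|]; last first.
  rewrite prodf_seq_eq0 => /hasP[m' m's /=].
  rewrite lin_sub_form; last by rewrite mi; apply/eqP/(allP si).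
  rewrite scaler_eq0 subr_eq0 => /orP[/eqP/natr_inj0/val_inj mE|]; last first.
    by rewrite -msize_poly_eq0 msizeX.
  by rewrite mE m's in ms.
have [h' ->] := lin_sub_dvd h0.
by exists h'; rewrite big_cons mulrA.
Qed.

Lemma block_neq0 i : block i != 0.
Proof.
by apply/prodf_neq0 => m _; have := forms_neq0 (lift ord0 m); rewrite forms_lift.
Qed.

Definition arr_basis (j : 'I_n.+2) : 'rV[S]_n.+2 :=
  oapp (fun i => \row_k (if k == v i then block i else 0)) (\row_k 'X_k) (unlift ord0 j).

Lemma arr_basis_comb (c : 'I_n.+2 -> S) k :
  (\sum_j c j *: arr_basis j) 0 k =
  c ord0 * 'X_k + oapp (fun i => c (v i) * block i) 0 (unlift ord0 k).
Proof.
rewrite big_ord_recl mxE summxE /arr_basis unlift_none /= !mxE; congr (_ + _).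
under eq_bigr => i _ do rewrite liftK /= !mxE.
case: unliftP => [i ->|->] /=.
  rewrite (bigD1 i) //= eqxx big1 ?addr0 // => j ji.
  by rewrite (inj_eq lift_inj) eq_sym (negPf ji) mulr0.
by rewrite big1 // => j _; rewrite mulr0.
Qed.

(** For w logarithmic, w_0 = g x_0. After subtracting g times the Euler derivation the conditions
    decouple: the i-th component is divisible by each form of block i, hence by the block. *)
Lemma arr_free : free_arrangement arr.
Proof.
have x0_neq0 : x0 != 0 by rewrite -msize_poly_eq0 msizeX.
have logP w : log_derivation arr w <->
    (exists g, w 0 ord0 = g * x0) /\
    forall m, exists g, w 0 (v (kap m)) - (m%:R : K) *: w 0 ord0 = g * lin_form m.
  have D0 : derivation_apply w x0 = w 0 ord0.
    rewrite /derivation_apply (bigD1 ord0) //= mderivXU eqxx mulr1 big1 ?addr0 // => i i0.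
    by rewrite mderivXU eq_sym (negPf i0) mulr0.
  split=> [logw|[w0 wm] j].
    split=> [|m]; first by have /ideal_gen_eq := logw ord0; rewrite /= forms0 D0.
    by have /ideal_gen_eq := logw (lift ord0 m); rewrite /= forms_lift derivation_applyE.
  apply/ideal_gen_eq; case: (unliftP ord0 j) => [m ->|->] /=; last by rewrite forms0 D0.
  by rewrite forms_lift derivation_applyE.
exists n.+2, arr_basis; split=> [j|w /logP[[g w0] wm]].
  apply/logP; rewrite /arr_basis; case: unliftP => [i _|_] /=; rewrite !mxE /=; split=> [|m].
  - by exists 0; rewrite mul0r.
  - rewrite !mxE scaler0 subr0 (inj_eq lift_inj); case: eqP => [<-|_]; last by exists 0; rewrite mul0r.
    by exists (\prod_(m' | (kap m' == kap m) && (m' != m)) lin_form m'); rewrite /block (bigD1 m) //= mulrC.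
  - by exists 1; rewrite mul1r.
  - by exists 1; rewrite !mxE mul1r.
have div_block i : exists h, w 0 (v i) - g * 'X_(v i) = h * block i.
  apply: block_dvd => m <-; have [h E] := wm m; exists (h - g).
  rewrite mulrBl -E w0 /lin_form mulrBr -scalerAr; ring.
have [h hE] := choice div_block.
pose c := [ffun j => oapp h g (unlift ord0 j)].
exists c; split=> [|c' wE].
  apply/rowP => k; rewrite arr_basis_comb !ffunE unlift_none /=.
  case: unliftP => [i ->|->] /=; last by rewrite addr0.
  by rewrite ffunE liftK /= -hE addrC subrK.
have c'0 : c' ord0 = g.
  move/rowP/(_ ord0): wE; rewrite arr_basis_comb unlift_none addr0 w0.
  by move/(mulIf x0_neq0).
apply/ffunP => j; rewrite ffunE; case: unliftP => [i ->|->] //=.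
apply: (mulIf (block_neq0 i)); rewrite -hE; move/rowP/(_ (v i)): wE.
by rewrite arr_basis_comb liftK /= c'0 => ->; rewrite addrC addKr.
Qed.

Local Notation Q := (arr_poly arr).

Lemma arr_polyE : Q = x0 * \prod_i block i.
Proof.
rewrite /arr_poly big_ord_recl /= forms0; congr (_ * _).
rewrite (eq_bigr lin_form); last by move=> m _; rewrite forms_lift.
by rewrite (partition_big kap predT).
Qed.

Lemma mderiv_prod0 (I : Type) (r : seq I) (P : pred I) (F : I -> S) k :
  (forall i, P i -> (F i)^`M(k) = 0) -> (\prod_(i <- r | P i) F i)^`M(k) = 0.
Proof.
move=> F0; elim/big_rec: _ => [|i f Pi f0]; first by rewrite -mpolyC1 mderivC.
by rewrite mderivM f0 F0 // mul0r mulr0 addr0.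
Qed.

Lemma mderiv_block i k : k != v i -> k != ord0 -> (block i)^`M(k) = 0.
Proof.
move=> ki k0; apply: mderiv_prod0 => m /eqP mi.
rewrite mderivB mderivZ !mderivXU mi ![_ == k]eq_sym (negPf ki) (negPf k0).
by rewrite scaler0 subr0.
Qed.

Lemma mderiv_arr_poly i : Q^`M(v i) = (block i)^`M(v i) * (x0 * \prod_(k | k != i) block k).
Proof.
rewrite arr_polyE (bigD1 i) //= mulrCA mderivM -[RHS]addr0; congr (_ + _).
rewrite mderivM mderivXU mul0r add0r mderiv_prod0 ?mulr0 // => k ki.
by rewrite mderiv_block // (inj_eq lift_inj) eq_sym.
Qed.

Lemma block_mderiv_arr_poly i : block i * Q^`M(v i) = (block i)^`M(v i) * Q.
Proof.
rewrite mderiv_arr_poly mulrCA; congr (_ * _).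
by rewrite arr_polyE [in RHS](bigD1 i) //= mulrCA.
Qed.

Lemma euler_arr_poly : \sum_j 'X_j * Q^`M(j) = (d.+1)%:R *: Q.
Proof.
pose D (f : S) := \sum_(j < n.+2) 'X_j * f^`M(j).
have DM f g : D (f * g) = D f * g + f * D g.
  rewrite /D mulr_suml mulr_sumr -big_split; apply: eq_bigr => j _ /=.
  by rewrite mderivM; ring.
have DX k : D 'X_k = 'X_k.
  rewrite /D (bigD1 k) //= mderivXU eqxx mulr1 big1 ?addr0 // => j jk.
  by rewrite mderivXU eq_sym (negPf jk) mulr0.
have DB f g : D (f - g) = D f - D g.
  by rewrite /D -sumrB; apply: eq_bigr => j _; rewrite mderivB mulrBr.
have DZ c f : D (c *: f) = c *: D f.
  by rewrite /D scaler_sumr; apply: eq_bigr => j _; rewrite mderivZ scalerAr.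
have DA j : D (forms j) = forms j.
  by apply: (forms_ind (P := fun f => D f = f)) => // m; rewrite DB DZ !DX.
have : D (\prod_(j <- index_enum 'I_d.+1) forms j) =
       (size (index_enum 'I_d.+1))%:R *: \prod_(j <- index_enum 'I_d.+1) forms j.
  elim: (index_enum _) => [|j r IHr].
    rewrite big_nil scale0r /D big1 // => j _.
    by rewrite -mpolyC1 mderivC mulr0.
  by rewrite big_cons DM DA IHr /= -scalerAr -[X in X + _]scale1r -scalerDl -natr1 addrC.
by rewrite -sum1_size sum_nat_const card_ord muln1.
Qed.

Lemma homog_mderiv e f k : f \is e.+1.-homog -> (f^`M(k) : S) \is e.-homog.
Proof.
move=> fh; apply/dhomogP => m; rewrite mcoeff_msupp mcoeff_deriv => fm.
have : f@_(m + U_(k)) != 0 by apply: contraNneq fm => ->; rewrite mul0rn.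
by rewrite -mcoeff_msupp => /(dhomogP _ _ _ fh); rewrite /= mdegD mdeg1 addn1 => -[].
Qed.

Lemma homog_mderivX e f k j : f \is e.-homog -> (f^`M(k) * 'X_j : S) \is e.-homog.
Proof.
case: e => [|e] fh; last by rewrite -[e.+1]addn1 dhomogM ?homog_mderiv ?homogX.
suff -> : f^`M(k) = 0 by rewrite mul0r dhomog0.
apply/mpolyP => m; rewrite mcoeff0 mcoeff_deriv (dhomog_nemf_coeff fh) ?mul0rn //=.
by rewrite mdegD mdeg1 addn1.
Qed.

Lemma homog_prod_card (I : finType) (P : pred I) (F : I -> S) :
  (forall i, P i -> F i \is 1.-homog) -> \prod_(i | P i) F i \is #|P|.-homog.
Proof.
move=> F1; rewrite -sum1_card.
elim/big_rec2: _ => [|i a f Pi IH]; first exact: dhomog1.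
by rewrite dhomogM // F1.
Qed.

Lemma block_homog i : block i \is #|[pred m | kap m == i]|.-homog.
Proof.
apply: homog_prod_card => m _.
by have := forms_homog (lift ord0 m); rewrite forms_lift.
Qed.

Lemma jac_homog j : Q^`M(j) \is d.-homog.
Proof.
apply: homog_mderiv; have dE : #|@predT 'I_d.+1| = d.+1 by rewrite -[RHS]card_ord; apply: eq_card.
by have := homog_prod_card (P := predT) (fun i _ => forms_homog i); rewrite dE.
Qed.

(* block i * dQ/dx_i = (d(block i)/dx_i) * Q, with Q written by Euler's formula. *)
Definition jac_syz (i : 'I_n.+1) (j : 'I_n.+2) : S :=
  (if j == v i then block i else 0) - (d.+1%:R : K)^-1 *: ((block i)^`M(v i) * 'X_j).

Lemma natS_neq0 m : (m.+1%:R : K) != 0.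
Proof. by apply/eqP => E; have := @natr_inj0 m.+1 0 E. Qed.

Lemma jac_syzP i : \sum_j jac_syz i j * Q^`M(j) = 0.
Proof.
under eq_bigr => j _ do rewrite /jac_syz mulrBl -scalerAl -mulrA.
rewrite sumrB -scaler_sumr -mulr_sumr euler_arr_poly -scalerAr scalerA mulVf ?natS_neq0 //.
rewrite scale1r (bigD1 (v i)) //= eqxx big1 ?addr0 ?block_mderiv_arr_poly ?subrr //.
by move=> j ji; rewrite (negPf ji) mul0r.
Qed.

Lemma jac_syz_homog i j : jac_syz i j \is #|[pred m | kap m == i]|.-homog.
Proof.
rewrite rpredB ?rpredZ ?homog_mderivX ?block_homog //.
by case: ifP => _; rewrite ?block_homog ?dhomog0.
Qed.

(** In column 0 only the Euler term, a multiple of s x_0, is left, so s = 0; the other columns then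
    reduce to b_i times block i. *)
Lemma jac_syz_indep (b : 'I_n.+1 -> S) :
  (forall j, \sum_i b i * jac_syz i j = 0) -> forall i, b i = 0.
Proof.
move=> bz i.
have E j : \sum_i b i * jac_syz i j =
    \sum_i b i * (if j == v i then block i else 0)
    - (d.+1%:R : K)^-1 *: (\sum_i b i * (block i)^`M(v i)) * 'X_j.
  rewrite -scalerAl mulr_suml scaler_sumr -sumrB; apply: eq_bigr => k _.
  by rewrite /jac_syz mulrBr -scalerAr mulrA.
set s := \sum_i b i * (block i)^`M(v i) in E.
have s0 : s = 0.
  have := bz ord0; rewrite E big1 ?sub0r => [/eqP|k _]; last by rewrite mulr0.
  rewrite oppr_eq0 -scalerAl scaler_eq0 invr_eq0 (negPf (natS_neq0 _)) /= mulf_eq0.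
  by rewrite -[X in _ || X]msize_poly_eq0 msizeX orbF => /eqP.
have := bz (v i); rewrite E s0 scaler0 mul0r subr0 (bigD1 i) //= eqxx big1 ?addr0.
  by move/eqP; rewrite mulf_eq0 (negPf (block_neq0 i)) orbF => /eqP.
by move=> k ki; rewrite (inj_eq lift_inj) eq_sym (negPf ki) mulr0.
Qed.

Lemma jacobian_idealE f :
  jacobian_ideal arr f <-> exists a : 'I_n.+2 -> S, f = \sum_j a j * Q^`M(j).
Proof.
split=> [|[a ->]]; last first.
  apply: ideal_sum => [|j _]; first exact: ideal_gen_ideal.
  by case: (ideal_gen_ideal (fun g => g = Q \/ exists i, g = Q^`M(i))) => _ _; apply;
     apply: ideal_of_gen; right; exists j.
move: f; apply: (@ideal_gen_min _ _ (fun f => exists a : 'I_n.+2 -> S, f = \sum_j a j * Q^`M(j))).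
  split; first by exists (fun=> 0); rewrite big1 // => j _; rewrite mul0r.
    move=> _ _ [a ->] [b ->]; exists (fun j => a j + b j).
    by rewrite -big_split; apply: eq_bigr => j _; rewrite mulrDl.
  move=> g _ [a ->]; exists (fun j => g * a j).
  by rewrite mulr_sumr; apply: eq_bigr => j _; rewrite mulrA.
move=> _ [->|[k ->]].
  exists (fun j => (d.+1%:R : K)^-1 *: 'X_j).
  under eq_bigr => j _ do rewrite -scalerAl.
  by rewrite -scaler_sumr euler_arr_poly scalerA mulVf ?natS_neq0 // scale1r.
exists (fun j => (j == k)%:R).
by rewrite (bigD1 k) //= eqxx mul1r big1 ?addr0 // => j /negPf ->; rewrite mul0r.
Qed.

Definition to_line : S -> {poly K} := mmap polyC (fun j => if j == ord0 then 1 else 'X).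
HB.instance Definition _ := GRing.RMorphism.copy to_line to_line.

Lemma to_lineC c : to_line c%:MP = c%:P.
Proof. by rewrite /to_line mmapC. Qed.

Lemma to_lineX j : to_line 'X_j = if j == ord0 then 1 else 'X.
Proof. by rewrite /to_line mmapX mmap1U. Qed.

Lemma to_lineZ c f : to_line (c *: f) = c *: to_line f.
Proof. by rewrite -mul_mpolyC rmorphM /= to_lineC mul_polyC. Qed.

(** Chain rule: along the line x_0 is constant and every other coordinate has derivative 1. *)
Lemma deriv_to_line f : (to_line f)^`() = \sum_i to_line (f^`M(v i)).
Proof.
elim/mpoly_ring_ind: f => [c|j|f g Ef Eg|f g Ef Eg].
- rewrite to_lineC derivC big1 // => i _; by rewrite mderivC rmorph0.
- rewrite to_lineX; case: (unliftP ord0 j) => [i ->|->] /=.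
    rewrite derivX (bigD1 i) //= mderivXU eqxx rmorph1 big1 ?addr0 // => k ki.
    by rewrite mderivXU (inj_eq lift_inj) eq_sym (negPf ki) rmorph0.
  by rewrite -polyC1 derivC big1 // => i _; rewrite mderivXU rmorph0.
- rewrite rmorphD derivD Ef Eg -big_split; apply: eq_bigr => i _ /=.
  by rewrite mderivD rmorphD.
- rewrite rmorphM derivM Ef Eg mulr_suml mulr_sumr -big_split; apply: eq_bigr => i _ /=.
  by rewrite mderivM rmorphD !rmorphM.
Qed.

Definition line_block i : {poly K} := \prod_(m | kap m == i) ('X - (m%:R)%:P).

Lemma to_line_block i : to_line (block i) = line_block i.
Proof.
rewrite rmorph_prod; apply: eq_bigr => m _.
by rewrite rmorphB /= to_lineZ !to_lineX /= alg_polyC.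
Qed.

Lemma to_line_mderiv i :
  to_line (Q^`M(v i)) = (line_block i)^`() * \prod_(k | k != i) line_block k.
Proof.
rewrite mderiv_arr_poly !rmorphM /= to_lineX mul1r rmorph_prod /=; congr (_ * _).
  rewrite -to_line_block deriv_to_line (bigD1 i) //= big1 ?addr0 // => k ki.
  by rewrite mderiv_block ?rmorph0 // (inj_eq lift_inj).
by apply: eq_bigr => k _; rewrite to_line_block.
Qed.

Lemma to_line_mderiv0 :
  to_line (Q^`M(ord0)) + 'X * \sum_i to_line (Q^`M(v i)) = (d.+1)%:R *: \prod_i line_block i.
Proof.
have toQ : to_line Q = \prod_i line_block i.
  rewrite arr_polyE rmorphM /= to_lineX mul1r rmorph_prod /=.
  by apply: eq_bigr => i _; rewrite to_line_block.
have := congr1 to_line euler_arr_poly; rewrite to_lineZ toQ => <-.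
rewrite [in RHS]big_ord_recl rmorphD rmorphM /= to_lineX mul1r; congr (_ + _).
rewrite [RHS]rmorph_sum mulr_sumr; apply: eq_bigr => i _.
by rewrite rmorphM /= to_lineX.
Qed.

End FreeArrangement.

(** * Restriction to a line *)

Section Wronskian.
Context (K : fieldType) (charK : [pchar K] =i pred0).

Lemma poly_nat_nonroot (p : {poly K}) : p != 0 -> exists m : nat, p.[m%:R] != 0.
Proof.
move=> p0; apply: contrapT => nex.
pose rs : seq K := [seq m%:R | m <- iota 0 (size p)].
have : (size rs < size p)%N.
  apply: max_poly_roots p0 _ _; last first.
    by rewrite map_inj_uniq ?iota_uniq //; apply: natr_inj0.
  apply/allP => _ /mapP[m _ ->]; apply/negPn/negP => pm.
  by apply: nex; exists m.
by rewrite size_map size_iota ltnn.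
Qed.

Lemma coef_prod_top (I : Type) (s : seq I) (F : I -> {poly K}) (D : I -> nat) :
  (forall i, (size (F i) <= (D i).+1)%N) ->
  (size (\prod_(i <- s) F i)%R <= (\sum_(i <- s) D i).+1)%N /\
  (\prod_(i <- s) F i)`_(\sum_(i <- s) D i) = \prod_(i <- s) (F i)`_(D i).
Proof.
move=> FD; elim: s => [|i s [IHs IHc]]; first by rewrite !big_nil size_poly1 coefC.
rewrite !big_cons; set p := \prod_(j <- s) F j in IHs IHc *; set E := (\sum_(j <- s) D j)%N in IHs IHc *.
split.
  apply: leq_trans (size_polyMleq _ _) _.
  by have := FD i; move: (size _) (size _) IHs => a b; lia.
rewrite coefM -IHc (bigD1 (inord (D i) : 'I_(D i + E).+1)) //= inordK ?ltnS ?leq_addr //.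
rewrite addKn big1 ?addr0 // => j ji.
have {ji} : (j : nat) != D i.
  by apply: contraNneq ji => jE; rewrite -val_eqE /= inordK ?jE // ltnS leq_addr.
rewrite neq_ltn => /orP[jD|Dj]; last by rewrite nth_default ?mul0r // (leq_trans (FD i)).
by rewrite [X in _ * X]nth_default ?mulr0 // (leq_trans IHs) //; lia.
Qed.

Lemma coef_det_top r (M : 'M[{poly K}]_r) (D : 'I_r -> nat) :
  (forall i j, (size (M i j) <= (D i).+1)%N) ->
  (\det M)`_(\sum_i D i) = \det (\matrix_(i, j) (M i j)`_(D i)).
Proof.
move=> MD; rewrite /determinant coef_sum; apply: eq_bigr => s _.
rewrite -[(-1) ^+ _ in LHS](rmorph_sign polyC) /= coefCM; congr (_ * _).
have [_ ->] := coef_prod_top (index_enum 'I_r) (fun i => MD i (s i)).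
by apply: eq_bigr => i _; rewrite mxE.
Qed.

(* A kernel vector h gives the polynomial \sum_j h_j 'C(X, j), of degree < r with
   the r roots D_i. *)
Lemma det_binomial_neq0 r (D : 'I_r -> nat) : injective D ->
  \det (\matrix_(i < r, j < r) ('C(D i, j)%:R : K)) != 0.
Proof.
move=> Dinj; apply/negP; rewrite -det_tr => /det0P[h h0 hM].
have hD i : \sum_j h 0 j * 'C(D i, j)%:R = 0.
  move/rowP/(_ i): hM; rewrite !mxE => hM; rewrite -[RHS]hM.
  by apply: eq_bigr => j _; rewrite !mxE.
pose ff j : {poly K} := \prod_(t < j) ('X - (t%:R)%:P).
have ffE j m : (ff j).[m%:R] = ('C(m, j) * j`!)%:R.
  rewrite bin_ffact /ff horner_prod ffact_prod natr_prod.
  have [jm|mj] := leqP j m.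
    apply: eq_bigr => t _; rewrite hornerXsubC natrB //.
    by apply: leq_trans (ltnW (ltn_ord t)) jm.
  rewrite (bigD1 (Ordinal mj)) //= hornerXsubC subrr mul0r.
  by rewrite (bigD1 (Ordinal mj)) //= subnn mul0r.
have fact0 j : (j`!%:R : K) != 0.
  by case: j`! (fact_gt0 j) => // m _; apply: natS_neq0.
pose H := \sum_j (h 0 j / (j : nat)`!%:R) *: ff j.
have HE m : H.[m%:R] = \sum_j h 0 j * 'C(m, j)%:R.
  rewrite /H horner_sum; apply: eq_bigr => j _.
  by rewrite hornerZ ffE natrM mulrACA mulVf // mulr1.
have H0 : H = 0.
  apply: (@roots_geq_poly_eq0 _ _ [seq (D i)%:R | i <- enum 'I_r]).
  - by apply/allP => _ /mapP[i _ ->]; apply/eqP; rewrite HE hD.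
  - rewrite map_inj_uniq ?enum_uniq // => i j /natr_inj0 E.
    by apply/Dinj/E.
  - rewrite size_map size_enum_ord; apply: leq_trans (size_sum _ _ _) _.
    apply/bigmax_leqP => j _; apply: leq_trans (size_scale_leq _ _) _.
    by rewrite size_prod_XsubC -sum1_size sum_nat_const card_ord muln1.
case/negP: h0; apply/eqP/rowP => j; rewrite mxE.
have [m] := ubnP (j : nat); elim: m j => // m IHm j jm.
have := HE j; rewrite H0 horner0 (bigD1 j) //= binn mulr1 big1 ?addr0 // => i ij.
case: (ltngtP i j) => [ilt|jlt|/val_inj E]; last by rewrite E eqxx in ij.
  by rewrite IHm ?mul0r // (leq_trans ilt).
by rewrite bin_small // mulr0.
Qed.

(** Multiplying column j by X^j bounds row i by degree D_i, with top coefficient lead(w_i) 'C(D_i,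
    j). The top coefficient of the determinant is thus a product of leading coefficients times the
    binomial determinant. *)
Lemma wronskian_neq0 r (w : 'I_r -> {poly K}) (D : 'I_r -> nat) :
  injective D -> (forall i, size (w i) = (D i).+1) ->
  \det (\matrix_(i < r, j < r) (w i)^`N(j)) != 0.
Proof.
move=> Dinj wD; set M := \matrix_(i, j) _.
pose M' : 'M[{poly K}]_r := \matrix_(i, j) ((w i)^`N(j) * 'X^j).
have M'E : M' = M *m diag_mx (\row_j 'X^j).
  by apply/matrixP => i j; rewrite mul_mx_diag !mxE.
suff : \det M' != 0 by rewrite M'E det_mulmx mulf_eq0 negb_or => /andP[].
have coefM' i j t : (D i <= t)%N -> ((w i)^`N(j) * 'X^j)`_t = (w i)`_t *+ 'C(t, j).
  move=> Dt; rewrite coefMXn; case: ltnP => tj; first by rewrite bin_small.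
  by rewrite coef_nderivn subnKC.
have M'D i j : (size (M' i j) <= (D i).+1)%N.
  apply/leq_sizeP => t Dt; rewrite mxE coefM' ?(ltnW Dt) //.
  by rewrite nth_default ?mul0rn // wD.
suff : (\det M')`_(\sum_i D i) != 0 by apply: contraNneq => ->; rewrite coef0.
rewrite coef_det_top //.
have -> : (\matrix_(i, j) (M' i j)`_(D i)) =
    diag_mx (\row_i lead_coef (w i)) *m (\matrix_(i < r, j < r) ('C(D i, j)%:R : K)).
  apply/matrixP => i j; rewrite mul_diag_mx !mxE coefM' // mulr_natr.
  by rewrite /lead_coef wD.
rewrite det_mulmx det_diag mulf_neq0 ?det_binomial_neq0 //.
by apply/prodf_neq0 => i _; rewrite mxE lead_coef_eq0 -size_poly_eq0 wD.
Qed.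

End Wronskian.

(** * Relations between the derivatives restricted to the line *)

Section LineJacobian.
Context (K : fieldType) (charK : [pchar K] =i pred0) (n d : nat) (kap : 'I_d -> 'I_n.+1).
Local Notation v := (lift ord0 : 'I_n.+1 -> 'I_n.+2).
Local Notation e i := #|[pred m | kap m == i]|.
Local Notation F j := (to_line ((arr_poly (arr charK kap))^`M(j))).
Local Notation p := (line_block K kap).
Local Notation q := (\prod_i line_block K kap i).

Lemma size_line_block i : size (p i) = (e i).+1.
Proof.
rewrite /line_block -big_filter size_prod_XsubC; congr _.+1.
by rewrite -sum1_size big_filter sum1_card.
Qed.

Lemma prod_line_blockE : q = \prod_(m : 'I_d) ('X - (m%:R)%:P).
Proof. by rewrite [RHS](partition_big kap predT). Qed.

Lemma size_prod_line_block : size q = d.+1.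
Proof.
by rewrite prod_line_blockE size_prod_XsubC -sum1_size sum_nat_const card_ord muln1.
Qed.

(** The roots of p_i are simple, so its derivative does not vanish there; nor do the other blocks,
    as no number lies in two blocks. *)
Lemma line_jac_coprime i : coprimep (p i) (F (v i)).
Proof.
rewrite (to_line_mderiv charK) {1}/line_block.
elim/big_rec: _ => [|m f /eqP mi IH]; first exact: coprime1p.
rewrite coprimepMl {}IH andbT coprimep_sym coprimep_XsubC rootM negb_or; apply/andP; split.
  rewrite /line_block (bigD1 m) ?mi //= derivM derivXsubC mul1r.
  rewrite rootE hornerD hornerM hornerXsubC subrr mul0r addr0.
  rewrite horner_prod; apply/prodf_neq0 => m' /andP[_ m'm]; rewrite hornerXsubC subr_eq0.
  by apply: contraNneq m'm => /(natr_inj0 charK)/val_inj ->.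
rewrite rootE horner_prod; apply/prodf_neq0 => k ki; rewrite horner_prod.
apply/prodf_neq0 => m' /eqP m'k; rewrite hornerXsubC subr_eq0.
by apply: contraNneq ki => /(natr_inj0 charK)/val_inj E; rewrite -m'k -mi E.
Qed.

Lemma line_block_dvd_jac i k : k != i -> p i %| F (v k).
Proof.
by move=> ki; rewrite (to_line_mderiv charK) (bigD1 i) 1?eq_sym //= mulrCA dvdp_mulr.
Qed.

Lemma sum_line_jac : \sum_i F (v i) = q^`().
Proof.
pose Q := arr_poly (arr charK kap).
suff <- : to_line Q = q by rewrite deriv_to_line.
rewrite /Q arr_polyE rmorphM /= to_lineX mul1r rmorph_prod /=.
by apply: eq_bigr => i _; rewrite to_line_block.
Qed.

Lemma line_jac0 : F ord0 = (d.+1)%:R *: q - 'X * q^`().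
Proof. by rewrite -(to_line_mderiv0 charK kap) -sum_line_jac addrK. Qed.

Lemma lead_q : q`_d = 1.
Proof.
have : q \is monic by rewrite prod_line_blockE monic_prod_XsubC.
by rewrite monicE /lead_coef size_prod_line_block => /eqP.
Qed.

Lemma coef_line_jac0 : (F ord0)`_d = 1 /\ (size (F ord0) <= d.+1)%N.
Proof.
have E t : (F ord0)`_t = (d.+1)%:R * q`_t - q`_t *+ t.
  rewrite line_jac0 coefB coefZ coefXM; congr (_ - _).
  by case: t => [|t]; rewrite ?mulr0n //= coef_deriv.
split; first by rewrite E lead_q mulr1 -mulrnBr // subSnn.
apply/leq_sizeP => t dt; rewrite E nth_default ?size_prod_line_block //.
by rewrite mulr0 mul0rn subr0.
Qed.

Lemma size_line_jac i : (size (F (v i)) <= d)%N.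
Proof.
rewrite (to_line_mderiv charK); have qE : q = p i * \prod_(k | k != i) p k by rewrite (bigD1 i).
have rest0 : \prod_(k | k != i) p k != 0.
  by apply/prodf_neq0 => k _; rewrite -size_poly_eq0 size_line_block.
have p0 : p i != 0 by rewrite -size_poly_eq0 size_line_block.
set rest := \prod_(k | k != i) p k in qE rest0 *.
have := size_prod_line_block; rewrite qE size_mul // size_line_block => sz.
apply: leq_trans (size_polyMleq _ _) _.
have := @lt_size_deriv _ (p i) p0; rewrite size_line_block.
move: sz; move: (size rest) (size (p i)^`()) => A B'; lia.
Qed.

(* Writing F_0 = (d+1) q - X q' and q' = \sum_i F_i, a relation reads
   (d+1) a_0 q + \sum_i (a_i - a_0 X) F_i = 0, so that the block polynomial p_i
   divides a_i - a_0 X. *)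
Lemma line_jac_syzygy k (a : 'I_n.+2 -> {poly K}) :
  (forall j, (size (a j) <= k.+1)%N) -> \sum_j a j * F j = 0 ->
  (forall i t, (e i <= t)%N -> (t <= k)%N -> (a (v i) - a ord0 * 'X)`_t = 0) ->
  forall j, a j = 0.
Proof.
move=> sa w0 az.
(* Only a_0 F_0 can reach degree k + d, and F_0 has coefficient 1 in degree d. *)
have a0k : (a ord0)`_k = 0.
  move/(congr1 (fun f : {poly K} => f`_(k + d))): w0.
  rewrite coef0 big_ord_recl coefD coef_sum big1 ?addr0; last first.
    move=> i _; rewrite nth_default // (leq_trans (size_polyMleq _ _)) //.
    by have := sa (v i); have := size_line_jac i; move: (size _) (size _) => A B' ? ?; lia.
  have [Fd sF] := coef_line_jac0.
  rewrite coefM (bigD1 (inord k : 'I_(k + d).+1)) //= inordK ?ltnS ?leq_addr // addKn.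
  rewrite Fd mulr1 big1 ?addr0 // => j jk.
  have {jk} : (j : nat) != k.
    by apply: contraNneq jk => jE; rewrite -val_eqE /= inordK ?jE // ltnS leq_addr.
  rewrite neq_ltn => /orP[jk|kj].
    by rewrite [X in _ * X]nth_default ?mulr0 // (leq_trans sF) //; lia.
  by rewrite nth_default ?mul0r // (leq_trans (sa _)).
have sa0 : (size (a ord0 * 'X)%R <= k.+1)%N.
  apply/leq_sizeP => t kt; rewrite coefMX; case: t kt => //= t.
  rewrite ltnS leq_eqVlt => /orP[/eqP <- //|kt].
  by rewrite nth_default // (leq_trans (sa _)).
have E : \sum_j a j * F j = (d.+1)%:R *: (a ord0 * q) + \sum_i (a (v i) - a ord0 * 'X) * F (v i).
  rewrite big_ord_recl line_jac0 -sum_line_jac mulrBr scalerAr -addrA; congr (_ + _).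
  under [X in _ = X]eq_bigr => i _ do rewrite mulrBl.
  by rewrite sumrB addrC -mulr_sumr mulrA.
(* Its coefficients vanish from e_i on, up to k by [az] and beyond by size, so a nonzero multiple of
   p_i is impossible. *)
have b0 i : a (v i) - a ord0 * 'X = 0.
  apply/eqP; rewrite -size_poly_eq0 -leqn0 leqNgt; apply/negP => sb.
  have pb : p i %| a (v i) - a ord0 * 'X.
    rewrite -(Gauss_dvdpl _ (line_jac_coprime i)).
    move: w0; rewrite E [X in _ + X](bigD1 i) //= addrCA => /eqP; rewrite addr_eq0 => /eqP ->.
    rewrite dvdpNr; apply: dvdp_add.
      by rewrite -mul_polyC !dvdp_mull // (bigD1 i) //= dvdp_mulr.
    elim/big_rec: _ => [|k' f ki fd]; first exact: dvdp0.
    by rewrite dvdp_add // dvdp_mull // line_block_dvd_jac.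
  have := dvdp_leq _ pb; rewrite -size_poly_gt0 => /(_ sb); apply/negP; rewrite -ltnNge size_line_block ltnS.
  apply/leq_sizeP => t et; have [|kt] := leqP t k; first exact: az.
  by rewrite coefB !nth_default ?subrr // (leq_trans _ kt).
have a0 : a ord0 = 0.
  move: w0; rewrite E [X in _ + X]big1 ?addr0 => [/eqP|i _]; last by rewrite b0 mul0r.
  rewrite scaler_eq0 (negPf (natS_neq0 charK d)) /= mulf_eq0 => /orP[/eqP //|].
  by move/eqP => q0; have := size_prod_line_block; rewrite q0 size_poly0.
move=> j; case: (unliftP ord0 j) => [i ->|->] //.
by have := b0 i; rewrite a0 mul0r subr0.
Qed.

(** With fewer than r attained degrees, some nonzero [a] would have a combination whose coefficient
    vanishes in each attained degree. Its own degree being attained, the combination would be 0,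
    against [line_jac_syzygy]. *)
Lemma line_jac_degrees k r : (\sum_i (k.+1 - e i) + r = n.+2 * k.+1)%N ->
  exists (D : 'I_r -> nat) (a : 'I_r -> 'I_n.+2 -> {poly K}),
    [/\ injective D, forall i j, (size (a i j) <= k.+1)%N &
        forall i, size (\sum_j a i j * F j) = (D i).+1].
Proof.
move=> count.
pose Dg := [set s : 'I_(k + d).+1 | `[< exists a : 'I_n.+2 -> {poly K},
  (forall j, (size (a j) <= k.+1)%N) /\ size (\sum_j a j * F j) = s.+1 >]].
have rD : (r <= #|Dg|)%N.
  rewrite leqNgt; apply/negP => Dr.
  (* The first summand indexes the equations in the degrees of [Dg], the second the coefficient
     conditions of [line_jac_syzygy]. *)
  pose I := ({s | s \in Dg} + {i : 'I_n.+1 & 'I_(k.+1 - e i)})%type.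
  pose J := ('I_n.+2 * 'I_k.+1)%type.
  pose C (jt : J) (x : I) : K := match x with
    | inl s => ('X^(jt.2) * F jt.1)`_(val s)
    | inr u => ((jt.1 == v (tag u))%:R *: 'X^(jt.2) - (jt.1 == ord0)%:R *: 'X^(jt.2.+1)
                : {poly K})`_(e (tag u) + tagged u)
    end.
  have [|c [[jt c0] sol]] := underdetermined_solution C.
    rewrite card_sum card_sig card_tagged card_prod !card_ord -count addnC.
    have -> : sumn [seq #|'I_(k.+1 - e i)| | i <- enum 'I_n.+1] = (\sum_i (k.+1 - e i))%N.
      by rewrite sumnE big_map big_enum; apply: eq_bigr => i _; rewrite card_ord.
    by rewrite ltn_add2l; apply: leq_ltn_trans Dr; apply/eq_leq/eq_card => s; rewrite !inE.
  pose a j := \sum_(t < k.+1) c (j, t) *: 'X^t : {poly K}.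
  have aE : a =1 fun j => \poly_(t < k.+1) (if insub t is Some u then c (j, u) else 0).
    by move=> j; rewrite poly_def; apply: eq_bigr => t _; rewrite valK.
  have sa j : (size (a j) <= k.+1)%N by rewrite aE size_poly.
  have w0 : \sum_j a j * F j = 0.
    apply/eqP; rewrite -size_poly_eq0 -leqn0 leqNgt; apply/negP => sw.
    set w := \sum_j _ in sw *.
    have wk : ((size w).-1 < (k + d).+1)%N.
      rewrite prednK // (leq_trans (size_sum _ _ _)) //; apply/bigmax_leqP => j _.
      apply: leq_trans (size_polyMleq _ _) _.
      have Fj : (size (F j) <= d.+1)%N.
        by case: (unliftP ord0 j) => [i ->|->]; [apply/leqW/size_line_jac | case: coef_line_jac0].
      by have := sa j; move: (size _) (size _) Fj => A B' ? ?; lia.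
    have wD : Ordinal wk \in Dg.
      by rewrite inE; apply/asboolP; exists a; split=> //=; rewrite prednK.
    have := sol (inl (exist (fun s : 'I_(k + d).+1 => s \in Dg) _ wD)); rewrite /C /= => lc.
    suff : lead_coef w == 0 by rewrite lead_coef_eq0 -size_poly_eq0 eqn0Ngt sw.
    apply/eqP; rewrite -[RHS]lc /lead_coef coef_sum.
    transitivity (\sum_j \sum_(t < k.+1) c (j, t) * ('X^t * F j)`_(size w).-1); last first.
      by rewrite pair_bigA; apply: eq_bigr => -[].
    apply: eq_bigr => j _; rewrite /a mulr_suml coef_sum; apply: eq_bigr => t _.
    by rewrite -scalerAl coefZ.
  have az i t : (e i <= t)%N -> (t <= k)%N -> (a (v i) - a ord0 * 'X)`_t = 0.
    move=> et tk; have ut : (t - e i < k.+1 - e i)%N by lia.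
    rewrite -[RHS](sol (inr (Tagged (fun i : 'I_n.+1 => 'I_(k.+1 - e i)) (Ordinal ut)))).
    rewrite /C /= subnKC //.
    transitivity (\sum_j ((j == v i)%:R * (a j)`_t - (j == ord0)%:R * (a j * 'X)`_t)).
      have delta j0 (G : 'I_n.+2 -> K) : \sum_j (j == j0)%:R * G j = G j0.
        by rewrite (bigD1 j0) //= eqxx mul1r big1 ?addr0 // => j /negPf ->; rewrite mul0r.
      by rewrite sumrB !delta coefB.
    transitivity (\sum_j \sum_(t' < k.+1) c (j, t') *
      ((j == v i)%:R *: 'X^t' - (j == ord0)%:R *: 'X^(t'.+1) : {poly K})`_t); last first.
      by rewrite pair_bigA; apply: eq_bigr => -[].
    apply: eq_bigr => j _; rewrite /a mulr_suml !coef_sum !mulr_sumr -sumrB.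
    apply: eq_bigr => t' _; rewrite -scalerAl -exprSr coefB !coefZ mulrBr.
    by congr (_ - _); rewrite mulrCA.
  have a0 := line_jac_syzygy sa w0 az.
  case: jt c0 => j t /eqP; apply.
  have /(congr1 (fun f : {poly K} => f`_t)) := a0 j.
  by rewrite aE coef_poly ltn_ord valK coef0.
have pick (i : 'I_r) : exists a : 'I_n.+2 -> {poly K}, (forall j, (size (a j) <= k.+1)%N) /\
    size (\sum_j a j * F j) = (enum_val (widen_ord rD i) : nat).+1.
  by have := enum_valP (widen_ord rD i); rewrite inE => /asboolP.
have [a aP] := choice pick.
exists (fun i => enum_val (widen_ord rD i) : nat), a; split.
- by move=> i i' /val_inj/enum_val_inj/(congr1 val) /= /val_inj.
- by move=> i j; case: (aP i).
- by move=> i; case: (aP i).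
Qed.

End LineJacobian.

(** * Generic coordinates *)

Section LinearChange.
Context (K : fieldType).

Section AnyDimension.
Context (l : nat).
Local Notation S := {mpoly K[l]}.
Implicit Types (g : 'M[K]_l) (f h : S).

HB.instance Definition _ g := GRing.RMorphism.copy (linear_change g : S -> S) (linear_change g).
HB.instance Definition _ g := GRing.Linear.copy (linear_change g : S -> S) (linear_change g).

Lemma linear_changeX g j : linear_change g 'X_j = \sum_i g i j *: 'X_i.
Proof. by rewrite /linear_change comp_mpolyXU -tnth_nth tnth_mktuple. Qed.

Lemma linear_changeC g c : linear_change g c%:MP = c%:MP :> S.
Proof. exact: comp_mpolyC. Qed.

Lemma linear_change_homog g e f : f \is e.-homog -> linear_change g f \is e.-homog.
Proof.
move=> fe; rewrite [f]mpolyE rmorph_sum /= big_seq rpred_sum // => m mf.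
rewrite linearZ /= rpredZ // -(dhomogP _ _ _ fe m mf).
rewrite mpolyXE_id rmorph_prod /= mdegE.
elim/big_rec2: _ => [|i a p _ IH]; first exact: dhomog1.
rewrite dhomogM // rmorphXn /= linear_changeX -[X in X.-homog]mul1n dhomogMn //.
by apply: rpred_sum => k _; rewrite rpredZ // dhomogX /= mdeg1.
Qed.

Lemma linear_changeM g g' f :
  linear_change g (linear_change g' f) = linear_change (g *m g') f.
Proof.
elim/mpoly_ring_ind: f => [c|j|f h Ef Eh|f h Ef Eh].
- by rewrite !linear_changeC.
- rewrite !linear_changeX rmorph_sum /=.
  under eq_bigr => i _ do rewrite linearZ /= linear_changeX scaler_sumr.
  rewrite exchange_big; apply: eq_bigr => k _.
  rewrite mxE scaler_suml; apply: eq_bigr => i _.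
  by rewrite scalerA mulrC.
- by rewrite !rmorphD /= Ef Eh.
- by rewrite !rmorphM /= Ef Eh.
Qed.

Lemma linear_change1 f : linear_change 1%:M f = f.
Proof.
elim/mpoly_ring_ind: f => [c|j|f h Ef Eh|f h Ef Eh].
- exact: linear_changeC.
- rewrite linear_changeX (bigD1 j) //= mxE eqxx scale1r big1 ?addr0 // => i ij.
  by rewrite mxE (negPf ij) scale0r.
- by rewrite rmorphD /= Ef Eh.
- by rewrite rmorphM /= Ef Eh.
Qed.

Lemma linear_changeK g : g \in unitmx -> cancel (linear_change g) (linear_change (invmx g) : S -> S).
Proof. by move=> gu f; rewrite linear_changeM mulVmx ?linear_change1. Qed.

(** This is the source of Zariski openness: conditions on coefficients become polynomial in the
    entries of g. *)
Lemma mcoeff_linear_change_poly f m : exists P : {mpoly K[l * l]},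
  forall g, P.@[fun k => mxvec g 0 k] = (linear_change g f)@_m.
Proof.
elim/mpoly_ring_ind: f m => [c|j|f h Ef Eh|f h Ef Eh] m.
- by exists (c%:MP@_m)%:MP => g; rewrite mevalC linear_changeC.
- exists (\sum_i (U_(i) == m)%MM%:R *: 'X_(mxvec_index i j)) => g.
  rewrite linear_changeX rmorph_sum raddf_sum /=; apply: eq_bigr => i _.
  by rewrite mevalZ mevalXU mxvecE mcoeffZ mcoeffX mulrC.
- have [P PE] := Ef m; have [P' PE'] := Eh m.
  by exists (P + P') => g; rewrite mevalD PE PE' rmorphD mcoeffD.
- have [P PE] := choice Ef; have [P' PE'] := choice Eh.
  exists (\sum_(k : 'X_{1..l < (mdeg m).+1, (mdeg m).+1} | m == (k.1 + k.2)%MM) P k.1 * P' k.2) => g.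
  rewrite rmorph_sum rmorphM mcoeffM /=; apply: eq_bigr => k _.
  by rewrite mevalM PE PE'.
Qed.

End AnyDimension.

Section Plane.
Context (n : nat).
Local Notation S := {mpoly K[n.+2]}.
Local Notation v := (lift ord0 : 'I_n.+1 -> 'I_n.+2).
Implicit Types (f h : S).

(** On forms of degree e this reads off coefficients: that of X^j belongs to x_0^(e-j) x_1^j, by
    [mcoeff_to_plane]. *)
Definition to_plane : S -> {poly K} :=
  mmap polyC (fun j => if j == ord0 then 1 else if j == v ord0 then 'X else 0).
HB.instance Definition _ := GRing.RMorphism.copy to_plane to_plane.

Lemma to_planeC c : to_plane c%:MP = c%:P.
Proof. by rewrite /to_plane mmapC. Qed.

Lemma to_planeXU j :
  to_plane 'X_j = if j == ord0 then 1 else if j == v ord0 then 'X else 0.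
Proof. by rewrite /to_plane mmapX mmap1U. Qed.

Lemma to_planeZ c f : to_plane (c *: f) = c *: to_plane f.
Proof. by rewrite -mul_mpolyC rmorphM /= to_planeC mul_polyC. Qed.

Lemma to_planeX m : to_plane 'X_[m] = if first_two m == m then 'X^(m (v ord0)) else 0.
Proof.
rewrite mpolyXE_id rmorph_prod /=; under eq_bigr => i _ do rewrite rmorphXn /= to_planeXU.
rewrite big_ord_recl big_ord_recl /= expr1n mul1r; case: eqP => [mE|nE].
  rewrite big1 ?mulr1 // => i _.
  have -> : m (v (lift ord0 i)) = 0%N by rewrite -mE mnmE.
  by rewrite expr0.
have [i i2 mi] : exists2 i : 'I_n.+2, (1 < i)%N & m i != 0%N.
  apply: contrapT => nex; apply: nE; apply/mnmP => i; rewrite mnmE; case: ltnP => // i2.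
  by apply/esym/eqP/negPn/negP => mi; apply: nex; exists i.
case: (unliftP ord0 i) i2 mi => [i' ->|-> //]; case: (unliftP ord0 i') => [i'' ->|-> //] _ mi.
by rewrite (bigD1 i'') //= expr0n (negPf mi) mul0r mulr0.
Qed.

Lemma mcoeff_to_plane e f j : f \is e.-homog -> (j <= e)%N ->
  f@_(mon2 n (e - j) j) = (to_plane f)`_j.
Proof.
move=> fe je; rewrite {2}[f]mpolyE rmorph_sum coef_sum /= {1}[f]mpolyE raddf_sum /=.
rewrite !big_seq; apply: eq_bigr => m mf.
rewrite to_planeZ coefZ mcoeffZ mcoeffX to_planeX first_two_mon2; congr (_ * _).
have := dhomogP _ _ _ fe m mf; rewrite /= => me.
case: eqP => [->|nE].
  by rewrite mon2_0 mon2_1 eqxx coefXn eqxx.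
case: eqP => [mE|]; last by rewrite coef0.
have me2 : (m ord0 + m (v ord0) = e)%N by rewrite -me -[in RHS]mE mdeg_mon2.
rewrite coefXn; case: eqP => // jE; case: nE.
by rewrite -mE jE; congr (mon2 n _ _); rewrite -me2 addnK.
Qed.

(* On the plane x_2 = ... = 0, this change maps x_0 to x_0 and every other variable
   to t x_0 + x_1; the entries outside the first two rows only make it invertible. *)
Definition plane_change (t : K) : 'M[K]_n.+2 :=
  \matrix_(i, j) if i == ord0 then (if j == ord0 then 1 else t)
                 else if i == v ord0 then (j != ord0)%:R else (i == j)%:R.

Lemma plane_change_unit t : plane_change t \in unitmx.
Proof.
rewrite unitmxE -det_tr det_trig.
  rewrite big1 ?unitr1 // => i _; rewrite !mxE eqxx.
  by case: eqP => // /eqP i0; rewrite if_same.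
apply/is_trig_mxP => i j ij; rewrite !mxE.
case: (j =P ord0) ij => [->//|_]; case: (j =P v ord0) => [->|_ ij].
  by rewrite ltnS leqn0 => /eqP i0; rewrite (_ : i = ord0) ?eqxx //; apply/val_inj.
by case: eqP => // ji; rewrite ji ltnn in ij.
Qed.

(** With [coef_comp_translate], the coefficients on the plane become Hasse derivatives at t of the
    restriction to the line, that is, Wronskian entries. *)
Lemma to_plane_change t f :
  to_plane (linear_change (plane_change t) f) = to_line f \Po ('X + t%:P).
Proof.
elim/mpoly_ring_ind: f => [c|j|f h Ef Eh|f h Ef Eh].
- by rewrite linear_changeC to_planeC to_lineC comp_polyC.
- rewrite linear_changeX rmorph_sum /=.
  under eq_bigr => i _ do rewrite to_planeZ to_planeXU.
  rewrite big_ord_recl big_ord_recl /= big1 => [|i _]; last by rewrite scaler0.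
  rewrite addr0 /plane_change !mxE /= to_lineX; case: eqVneq => _ /=.
    by rewrite scale1r scale0r addr0 -polyC1 comp_polyC.
  by rewrite scale1r comp_polyX addrC alg_polyC.
- by rewrite !rmorphD /= Ef Eh.
- by rewrite !rmorphM /= Ef Eh.
Qed.

Lemma coef_comp_translate (p : {poly K}) t j : (p \Po ('X + t%:P))`_j = p^`N(j).[t].
Proof.
rewrite /comp_poly addrC nderiv_taylor; last exact: mulrC.
under eq_bigr => i _ do rewrite nderivn_map horner_map /= mul_polyC.
rewrite -(poly_def _ (fun i => p^`N(i).[t])) coef_poly size_map_polyC.
case: ltnP => // pj; suff -> : p^`N(j) = 0 by rewrite horner0.
apply/polyP => i; rewrite coef_nderivn coef0 nth_default ?mul0rn //.
by rewrite (leq_trans pj) // leq_addr.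
Qed.

(** A preimage of p under [to_line] that is homogeneous of degree k; x_0, being 1 on the line, pads
    the degree. *)
Definition homogenize k (p : {poly K}) : S :=
  \sum_(t < k.+1) p`_t *: 'X_[mon2 n (k - t) t].

Lemma homogenize_homog k p : homogenize k p \is k.-homog.
Proof.
apply: rpred_sum => t _; rewrite rpredZ // dhomogX /= mdeg_mon2 subnK //.
by rewrite -ltnS.
Qed.

Lemma to_line_homogenize k (p : {poly K}) : (size p <= k.+1)%N -> to_line (homogenize k p) = p.
Proof.
move=> sp; rewrite rmorph_sum /= -[RHS](take_poly_id sp) /take_poly poly_def.
apply: eq_bigr => t _; rewrite to_lineZ; congr (_ *: _).
rewrite /to_line mmapX /mmap1 big_ord_recl big_ord_recl /= mon2_0 mon2_1 expr1n mul1r.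
rewrite big1 ?mulr1 // => i _; by rewrite mon2_ge2 ?expr0.
Qed.

(** Within one degree, degrevlex puts every monomial involving x_2, x_3, ... below all those in x_0
    and x_1, and orders the latter by decreasing power of x_1. *)
Lemma is_lead_mon2 e f j : f \is e.-homog -> (j <= e)%N ->
  f@_(mon2 n (e - j) j) != 0 -> (forall j', (j' < j)%N -> f@_(mon2 n (e - j') j') = 0) ->
  is_lead_monomial f (mon2 n (e - j) j).
Proof.
move=> fe je fj f0; split; first by rewrite mcoeff_msupp.
move=> m mf mj; have := dhomogP _ _ _ fe m mf; rewrite /= => me.
rewrite /degrevlex_lt mdeg_mon2 subnK // me ltnn eqxx /=.
have [[i0 i02 mi0]|nex] := pselect (exists2 i : 'I_n.+2, (1 < i)%N & m i != 0%N).
  have Pi0 : (m i0 != 0%N) && (1 < i0)%N by rewrite mi0.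
  (* The last variable of m decides the comparison. *)
  case: (arg_maxnP (P := fun i : 'I_n.+2 => (m i != 0%N) && (1 < i)%N)
           (fun i : 'I_n.+2 => (i : nat)) Pi0) => i /andP[mi i2] imax.
  apply/existsP; exists i; rewrite mon2_ge2 // lt0n mi /=.
  apply/forallP => k; apply/implyP => ik; have k2 := ltn_trans i2 ik.
  rewrite mon2_ge2 //; apply/negPn/negP => mk.
  have ki : (k <= i)%N by apply: imax; rewrite mk k2.
  by rewrite leqNgt ik in ki.
have mE : m = mon2 n (m ord0) (m (v ord0)).
  rewrite -first_two_mon2; apply/mnmP => i; rewrite mnmE; case: ltnP => // i2.
  by apply/eqP/negPn/negP => mi; apply: nex; exists i.
have m0 : m ord0 = (e - m (v ord0))%N by rewrite -me [in mdeg m]mE mdeg_mon2 addnK.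
apply/existsP; exists (v ord0); rewrite mon2_1; apply/andP; split; last first.
  by apply/forallP => k; apply/implyP => k2; rewrite mE !mon2_ge2.
rewrite ltnNge leq_eqVlt; apply/negP => /orP[/eqP jE|jlt].
  by case/eqP: mj; rewrite mE m0 jE.
by move: mf; rewrite mcoeff_msupp mE m0 f0 ?eqxx.
Qed.

End Plane.
End LinearChange.

Section GenericLeads.
Context (K : fieldType) (charK : [pchar K] =i pred0) (n d : nat) (kap : 'I_d -> 'I_n.+1).
Local Notation S := {mpoly K[n.+2]}.
Local Notation e i := #|[pred m | kap m == i]|.
Local Notation A := (arr charK kap).
Local Notation Q := (arr_poly A).

Definition plane_leads k r (g : 'M[K]_n.+2) := forall j, (j < r)%N ->
  exists2 h, jacobian_ideal A h &
    is_lead_monomial (linear_change g h) (mon2 n (d + k - j) j).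

(** P is the determinant of the coefficients of r changed elements of the Jacobian ideal at the r
    largest monomials. Where it is nonzero, the rows of the inverse matrix give combinations with
    one prescribed leading monomial each; [Delta] is the Wronskian on the line. *)
Lemma plane_leads_poly k r : (r <= (d + k).+1)%N ->
  (\sum_i (k.+1 - e i) + r = n.+2 * k.+1)%N ->
  exists (P : {mpoly K[n.+2 * n.+2]}) (Delta : {poly K}),
    [/\ Delta != 0,
        forall t, P.@[fun i => mxvec (plane_change n t) 0 i] = Delta.[t] &
        forall g, P.@[fun i => mxvec g 0 i] != 0 -> plane_leads k r g].
Proof.
move=> rdk count.
have [D [a [Dinj sa wD]]] := line_jac_degrees charK count.
pose G i := \sum_j homogenize n k (a i j) * Q^`M(j).
have Gh i : G i \is (d + k).-homog.
  by apply: rpred_sum => j _; rewrite addnC dhomogM ?homogenize_homog ?jac_homog.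
have GJ i : jacobian_ideal A (G i) by apply/jacobian_idealE; exists (fun j => homogenize n k (a i j)).
have Gw i : to_line (G i) = \sum_j a i j * to_line (Q^`M(j)).
  rewrite rmorph_sum; apply: eq_bigr => j _.
  by rewrite rmorphM /= to_line_homogenize.
have coefP (ij : 'I_r * 'I_r) := mcoeff_linear_change_poly (G ij.1) (mon2 n (d + k - ij.2) ij.2).
have [p pE] := choice coefP.
pose M g := \matrix_(i < r, j < r) (linear_change g (G i))@_(mon2 n (d + k - j) j).
have PE g : (\det (\matrix_(i < r, j < r) p (i, j))).@[fun i => mxvec g 0 i] = \det (M g).
  rewrite -det_map_mx; congr (\det _); apply/matrixP => i j.
  by rewrite [RHS]mxE -(pE (i, j)) [LHS]mxE /=; congr meval; rewrite mxE.
exists (\det (\matrix_(i < r, j < r) p (i, j))),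
  (\det (\matrix_(i < r, j < r) (to_line (G i))^`N(j))); split.
- by apply: (wronskian_neq0 charK Dinj) => i; rewrite Gw.
- move=> t; rewrite PE -horner_evalE -det_map_mx; congr (\det _); apply/matrixP => i j.
  rewrite !mxE (@mcoeff_to_plane _ _ (d + k)) ?linear_change_homog //; last first.
    by rewrite -ltnS (leq_trans (ltn_ord j)).
  by rewrite to_plane_change coef_comp_translate.
- move=> g; rewrite PE => detM j jr.
  have Mu : M g \in unitmx by rewrite unitmxE unitfE.
  pose h := \sum_i (invmx (M g)) (Ordinal jr) i *: G i.
  have hJ : jacobian_ideal A h.
    apply: ideal_sum => [|i _]; first exact: ideal_gen_ideal.
    have [_ _ JM] := ideal_gen_ideal (fun g => g = Q \/ exists i, g = Q^`M(i)).
    by rewrite -mul_mpolyC; apply: JM; apply: GJ.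
  have hh : linear_change g h \is (d + k).-homog.
    by apply: linear_change_homog; apply: rpred_sum => i _; rewrite rpredZ.
  have hc (j' : 'I_r) : (linear_change g h)@_(mon2 n (d + k - j') j') = (Ordinal jr == j')%:R.
    have := mulVmx Mu; move/matrixP/(_ (Ordinal jr) j'); rewrite !mxE => <-.
    rewrite rmorph_sum raddf_sum /=; apply: eq_bigr => i _.
    by rewrite linearZ mcoeffZ mxE.
  exists h => //; apply: is_lead_mon2 hh _ _ _.
  + by rewrite -ltnS (leq_trans jr).
  + by rewrite (hc (Ordinal jr)) eqxx oner_eq0.
  + move=> j' j'j; have j'r := ltn_trans j'j jr; rewrite (hc (Ordinal j'r)).
    by rewrite -val_eqE /= gtn_eqF.
Qed.

(** One open set has to serve T degrees, so the determinants are multiplied. All are tested on the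
    same curve [plane_change], so the set is nonempty as soon as a product of nonzero polynomials in
    t has a nonroot. *)
Lemma generic_plane_leads T (r : nat -> nat) :
  (forall k, (r k <= (d + k).+1)%N) ->
  (forall k, (\sum_i (k.+1 - e i) + r k = n.+2 * k.+1)%N) ->
  exists U, [/\ zariski_open_GL U, exists g, U g &
    forall g, U g -> g \in unitmx /\ forall k, (k < T)%N -> plane_leads k (r k) g].
Proof.
move=> rd count.
have [P PP] := choice (fun k => plane_leads_poly (rd k) (count k)).
have [Delta PD] := choice PP.
pose Ptot := \prod_(k < T) P k.
exists (fun g => g \in unitmx /\ exists2 p, p = Ptot & p.@[fun k => mxvec g 0 k] != 0); split.
- by exists (eq^~ Ptot).
- have D0 : \prod_(k < T) Delta k != 0 by apply/prodf_neq0 => k _; case: (PD k).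
  have [t Dt] := poly_nat_nonroot charK D0.
  exists (plane_change n t%:R); split; first exact: plane_change_unit.
  exists Ptot => //; apply: contraNneq Dt; rewrite rmorph_prod horner_prod /= => <-.
  by apply/eqP; apply: eq_bigr => k _; case: (PD k) => _ ->.
- move=> g [gu [p -> Pg]]; split=> // k kT; have [_ _] := PD k; apply.
  move: Pg; rewrite rmorph_prod => /prodf_neq0/(_ (Ordinal kT) isT) /=.
  by [].
Qed.

End GenericLeads.

(** * Counting leading monomials *)

Section LeadMonomials.
Context (K : fieldType) (l : nat).
Local Notation S := {mpoly K[l]}.
Implicit Types (m : 'X_{1..l}) (f : S).

Lemma degrevlex_irrefl m : degrevlex_lt m m = false.
Proof.
rewrite /degrevlex_lt ltnn eqxx /=; apply/existsP => -[j].
by rewrite ltnn.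
Qed.

Lemma degrevlexP m1 m2 : mdeg m1 = mdeg m2 ->
  reflect (exists2 j : 'I_l, (m2 j < m1 j)%N & forall k : 'I_l, (j < k)%N -> m1 k = m2 k)
          (degrevlex_lt m1 m2).
Proof.
move=> m12; rewrite /degrevlex_lt m12 ltnn eqxx /=.
apply: (iffP existsP) => [[j /andP[lt_j /forallP eq_j]]|[j lt_j eq_j]]; exists j => //.
  by move=> k jk; apply/eqP; have := eq_j k; rewrite jk.
by rewrite lt_j; apply/forallP => k; apply/implyP => /eq_j ->.
Qed.

Lemma degrevlex_mdeg m1 m2 : degrevlex_lt m1 m2 -> (mdeg m1 <= mdeg m2)%N.
Proof. by case/orP => [/ltnW //|/andP[/eqP-> _]]. Qed.

Lemma degrevlex_trans m2 m1 m3 :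
  degrevlex_lt m1 m2 -> degrevlex_lt m2 m3 -> degrevlex_lt m1 m3.
Proof.
move=> h12 h23; have d12 := degrevlex_mdeg h12; have d23 := degrevlex_mdeg h23.
have [d13|d31] := ltnP (mdeg m1) (mdeg m3); first by rewrite /degrevlex_lt d13.
have e12 : mdeg m1 = mdeg m2 by lia.
have e23 : mdeg m2 = mdeg m3 by lia.
case/(degrevlexP e12): h12 => i lti eqi; case/(degrevlexP e23): h23 => j ltj eqj.
apply/degrevlexP; first by rewrite e12.
case: (ltngtP i j) => [ij|ji|/val_inj ij].
- by exists j => [|k jk]; [rewrite eqi | rewrite eqi ?eqj // (ltn_trans ij)].
- by exists i => [|k ik]; [rewrite -eqj | rewrite eqi ?eqj // (ltn_trans ji)].
- by exists i => [|k ik]; [rewrite (ltn_trans _ lti) // ij | rewrite eqi ?eqj // -ij].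
Qed.

Lemma degrevlex_add2l c m1 m2 : degrevlex_lt m1 m2 -> degrevlex_lt (c + m1)%MM (c + m2)%MM.
Proof.
rewrite /degrevlex_lt !mdegD ltn_add2l eqn_add2l => /orP[->//|].
case/andP=> -> /existsP[j /andP[lt_j /forallP eq_j]].
apply/orP; right; apply/existsP; exists j; rewrite !mnmDE ltn_add2l lt_j.
by apply/forallP => k; rewrite !mnmDE eqn_add2l eq_j.
Qed.

Lemma is_lead_mulX c f m : is_lead_monomial f m -> is_lead_monomial ('X_[c] * f) (c + m)%MM.
Proof.
move=> [mf fm]; rewrite mulrC; split; first by rewrite mcoeff_msupp mcoeffMX -mcoeff_msupp.
move=> m'; rewrite (perm_mem (msuppMX _ _)) => /mapP[m'' m''f ->].
rewrite eqm_add2l => ne; apply: degrevlex_add2l; exact: fm.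
Qed.

Lemma lead_independent (T : finType) (w : T -> S) (mon : T -> 'X_{1..l}) (c : T -> K) :
  injective mon -> (forall t, is_lead_monomial (w t) (mon t)) ->
  \sum_t c t *: w t = 0 -> forall t, c t = 0.
Proof.
move=> mon_inj lead sum0 t0; apply/eqP/negPn/negP => ct0.
(* The number of smaller leading monomials serves as a natural-number rank for choosing a maximal
   one. *)
pose rk t := #|[pred t' | degrevlex_lt (mon t') (mon t)]|.
case: (arg_maxnP (P := fun t => c t != 0) rk ct0) => t ct tmax.
move/(congr1 (mcoeff (mon t))): sum0; rewrite raddf_sum mcoeff0 (bigD1 t) //=.
rewrite big1 ?addr0 => [|t' t't]; rewrite mcoeffZ.
  by move/eqP; rewrite mulf_eq0 (negPf ct) /= mcoeff_eq0; case: (lead t) => ->.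
have [->|ct'] := eqVneq (c t') 0; first by rewrite mul0r.
apply/eqP; rewrite mulf_eq0 mcoeff_eq0 -implyNb; apply/implyP => _; apply/negP => mt.
have tt' : degrevlex_lt (mon t) (mon t').
  by case: (lead t') => _; apply=> //; rewrite (inj_eq mon_inj) eq_sym.
have : (rk t' <= rk t)%N by apply: tmax.
rewrite leqNgt => /negP; apply; apply: proper_card; apply/properP; split.
  by apply/subsetP => u; rewrite !inE => ut; apply: degrevlex_trans ut tt'.
by exists t; rewrite inE // degrevlex_irrefl.
Qed.

Lemma pihomogM d e (a f : S) : f \is d.-homog ->
  pihomog mdeg (e + d) (a * f) = pihomog mdeg e a * f.
Proof.
move=> fd; rewrite [a]mpolyE mulr_suml !raddf_sum mulr_suml /=; apply: eq_bigr => m _.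
rewrite -scalerAl !linearZ /= -scalerAl; congr (_ *: _).
have mfd : 'X_[m] * f \is (mdeg m + d).-homog by rewrite dhomogM // dhomogX.
rewrite pihomogX; have [<-|me] := eqVneq (mdeg m) e; first exact: pihomog_dE.
by rewrite mul0r (pihomog_ne0 _ mfd) ?eqn_add2r.
Qed.

Lemma pihomogM_lt d e (a f : S) : f \is d.-homog -> (e < d)%N -> pihomog mdeg e (a * f) = 0.
Proof.
move=> fd ed; rewrite [a]mpolyE mulr_suml raddf_sum /= big1 // => m _.
rewrite -scalerAl linearZ /=.
have mfd : 'X_[m] * f \is (mdeg m + d).-homog by rewrite dhomogM // dhomogX.
by rewrite (pihomog_ne0 _ mfd) ?scaler0 //; lia.
Qed.

Lemma mcoeff_pihomog e f m : (pihomog mdeg e f)@_m = if mdeg m == e then f@_m else 0.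
Proof.
rewrite pihomogE raddf_sum /= big_mkcond [in RHS](mpolyE f) raddf_sum /=.
under eq_bigr => m' _ do rewrite mcoeffZ mcoeffX.
under [in RHS]eq_bigr => m' _ do rewrite mcoeffZ mcoeffX.
case: eqP => me; last first.
  apply: big1 => m' _; case: eqP => // m'e; case: eqP => [m'm|]; rewrite ?mulr0 //.
  by case: me; rewrite -m'm.
apply: eq_bigr => m' _; case: eqP => // m'e; case: eqP => [m'm|]; rewrite ?mulr0 //.
by case: m'e; rewrite m'm.
Qed.

(** Taking the component of degree mdeg m - d in each coefficient extracts the component of degree
    mdeg m of the combination, which keeps m as leading monomial. *)
Lemma homog_lead N d (F a : 'I_N -> S) m : (forall j, F j \is d.-homog) ->
  is_lead_monomial (\sum_j a j * F j) m ->
  (d <= mdeg m)%N /\ exists2 b : 'I_N -> S, (forall j, b j \is (mdeg m - d).-homog) &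
    is_lead_monomial (\sum_j b j * F j) m.
Proof.
set f := \sum_j _ => Fd [mf fm].
have supp_f m' : (m' \in msupp (pihomog mdeg (mdeg m) f)) = (mdeg m' == mdeg m) && (m' \in msupp f).
  by rewrite !mcoeff_msupp mcoeff_pihomog; case: (mdeg m' =P _); rewrite ?eqxx.
have dm : (d <= mdeg m)%N.
  rewrite leqNgt; apply/negP => md; have := supp_f m; rewrite eqxx mf raddf_sum /= big1.
    by rewrite msupp0.
  by move=> j _; apply: (pihomogM_lt _ (Fd j) md).
split=> //; exists (fun j => pihomog mdeg (mdeg m - d) (a j)); first by move=> j; apply: pihomogP.
have -> : \sum_j pihomog mdeg (mdeg m - d) (a j) * F j = pihomog mdeg (mdeg m) f.
  rewrite raddf_sum; apply: eq_bigr => j _; by rewrite -(pihomogM _ _ (Fd j)) subnK.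
split; first by rewrite supp_f eqxx mf.
by move=> m'; rewrite supp_f => /andP[_ m'f]; apply: fm.
Qed.

End LeadMonomials.

Lemma card_sigT_ord (T : finType) (N : T -> nat) : #|{: {x : T & 'I_(N x)}}| = (\sum_x N x)%N.
Proof.
rewrite card_tagged sumnE big_map big_enum; apply: eq_bigr => x _.
by rewrite card_ord.
Qed.

Section TailMonomials.
Context (n : nat).
Implicit Types (c m : 'X_{1..n.+2}).

Definition is_tail c := (c ord0 == 0%N) && (c (lift ord0 ord0) == 0%N).

(* The monomials of degree s, indexed by their part c in the variables x_2, x_3, ...
   and the exponent u of x_1. *)
Definition tail_mon c s u : 'X_{1..n.+2} := (c + mon2 n (s - mdeg c - u) u)%MM.

Lemma tail_mon_0 c s u : is_tail c -> tail_mon c s u ord0 = (s - mdeg c - u)%N.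
Proof. by case/andP => /eqP c0 _; rewrite mnmDE c0 mon2_0. Qed.

Lemma tail_mon_1 c s u : is_tail c -> tail_mon c s u (lift ord0 ord0) = u.
Proof. by case/andP => _ /eqP c1; rewrite mnmDE c1 mon2_1. Qed.

Lemma tail_mon_inj c c' s s' u u' : is_tail c -> is_tail c' ->
  tail_mon c s u = tail_mon c' s' u' -> c = c' /\ u = u'.
Proof.
move=> ct c't E; split; last by have := congr1 (fun m => m (lift ord0 ord0)) E; rewrite /= !tail_mon_1.
apply/mnmP; case/andP: ct => /eqP c0 /eqP c1; case/andP: c't => /eqP c'0 /eqP c'1.
apply: mnm_first_two => [||i i2]; rewrite ?c0 ?c1 //.
have := congr1 (fun m : 'X_{1..n.+2} => m i) E.
by rewrite /= ![(_ + mon2 _ _ _)%MM i]mnmDE !mon2_ge2 // !addn0.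
Qed.

Lemma mdeg_tail_mon c s u : (u < s.+1 - mdeg c)%N -> mdeg (tail_mon c s u) = s.
Proof. by rewrite mdegD mdeg_mon2; lia. Qed.

Lemma tail_mon_tail m : let c := (m - first_two m)%MM in
  [/\ is_tail c, (mdeg c + m (lift ord0 ord0) <= mdeg m)%N &
      tail_mon c (mdeg m) (m (lift ord0 ord0)) = m].
Proof.
move=> c; have ct : is_tail c by rewrite /is_tail !mnmBE !mnmE /= !subnn.
have le_m : (first_two m <= m)%MM by apply/mnm_lepP => i; rewrite mnmE; case: ifP.
have mE : (c + first_two m)%MM = m by apply: submK.
have dE : (mdeg m = mdeg c + (m ord0 + m (lift ord0 ord0)))%N.
  by rewrite -{1}mE mdegD first_two_mon2 mdeg_mon2.
split=> //; first by rewrite dE addnA addnAC leq_addr.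
rewrite -[RHS]mE /tail_mon first_two_mon2; congr (_ + mon2 n _ _)%MM.
by rewrite dE addKn addnK.
Qed.

End TailMonomials.

Section LeadCount.
Context (K : fieldType) (n d : nat).
Local Notation S := {mpoly K[n.+2]}.
Context (F : 'I_n.+2 -> S) (psi : 'I_n.+1 -> 'I_n.+2 -> S) (e : 'I_n.+1 -> nat) (R : nat -> nat).
Hypothesis F_homog : forall j, F j \is d.-homog.
Hypothesis psi_homog : forall i j, psi i j \is (e i).-homog.
Hypothesis psiF : forall i, \sum_j psi i j * F j = 0.
Hypothesis psi_indep : forall b : 'I_n.+1 -> S,
  (forall j, \sum_i b i * psi i j = 0) -> forall i, b i = 0.
Hypothesis R_le : forall t, (R t <= t.+1)%N.
Hypothesis R_count : forall k, (\sum_i (k.+1 - e i) + R (d + k) = n.+2 * k.+1)%N.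
Hypothesis leads : forall t j, (j < R t)%N ->
  exists a : 'I_n.+2 -> S, is_lead_monomial (\sum_i a i * F i) (mon2 n (t - j) j).

(* A further leading monomial m would make the lifts of the elements with the leading
   monomials given by R, those of m, and the multiples of the syzygies linearly
   independent, and too many: for each tail c their number is given by R_count. *)
Lemma lead_in_rows (a : 'I_n.+2 -> S) m : is_lead_monomial (\sum_j a j * F j) m ->
  (m (lift ord0 ord0) < R (m ord0 + m (lift ord0 ord0)))%N.
Proof.
move/(homog_lead F_homog) => [dm [b b_homog b_lead]]; apply/negPn/negP => mR.
set E := mdeg m in dm b_homog *; set k := (E - d)%N in b_homog *.
have Ek : E = (d + k)%N by rewrite subnKC.
pose C := {c : 'X_{1..n.+2 < E.+1} | is_tail (bmnm c)}.
have CT (c : C) : is_tail (bmnm (val c)) by case: c.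
have CE (c : C) : (mdeg (bmnm (val c)) <= E)%N by rewrite -ltnS bmdeg.
(* [T1] indexes the tail multiples of the monomials given by [leads], [T2] the monomial multiples of
   the syzygies, [I] the coefficients of l forms of degree k. Throughout, c is a tail and the
   ordinal an exponent of x_1. *)
pose T1 := {c : C & 'I_(R (E - mdeg (bmnm (val c))))}.
pose T2 := {p : C * 'I_n.+1 & 'I_(k.+1 - mdeg (bmnm (val p.1)) - e p.2)}.
pose I := {p : C * 'I_n.+2 & 'I_(k.+1 - mdeg (bmnm (val p.1)))}.
pose mon1 (t : T1) := tail_mon (val (tag t)) E (tagged t).
have /choice[A1 A1P] (t : T1) : exists A : 'I_n.+2 -> S, (forall j, A j \is k.-homog) /\
    is_lead_monomial (\sum_j A j * F j) (mon1 t).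
  case: t => c u; have [A /(homog_lead F_homog)] := leads (ltn_ord u).
  have uE : (u <= E - mdeg (val c))%N by rewrite -ltnS (leq_trans (ltn_ord u)) ?R_le.
  rewrite mdeg_mon2 subnK // => -[dE [B B_homog B_lead]].
  exists (fun j => 'X_[val c] * B j); split=> [j|].
    have -> : k = (mdeg (val c) + (E - mdeg (val c) - d))%N by have := CE c; rewrite /k; lia.
    by rewrite dhomogM // dhomogX.
  have := is_lead_mulX (val c) B_lead; rewrite /mon1 mulr_sumr.
  by under eq_bigr => j _ do rewrite mulrA.
pose vec (x : option T1 + T2) (j : 'I_n.+2) : S := match x with
  | inl (Some t) => A1 t j
  | inl None => b j
  | inr y => 'X_[tail_mon (val (tag y).1) (k - e (tag y).2) (tagged y)] * psi (tag y).2 j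
  end.
have vec_homog x j : vec x j \is k.-homog.
  case: x => [[t|]|[[c i] u]] /=; [by case: (A1P t) | exact: b_homog |].
  have uk := ltn_ord u; rewrite /= in uk.
  rewrite -[X in X.-homog](@subnK (e i)); last by lia.
  by rewrite dhomogM // dhomogX /= mdeg_tail_mon //; lia.
pose coord (x : option T1 + T2) (q : I) : K :=
  (vec x (tag q).2)@_(tail_mon (val (tag q).1) k (tagged q)).
have [|gam [[x0 gam0] sol]] := underdetermined_solution coord.
  rewrite card_sum card_option !card_sigT_ord.
  rewrite -(pair_bigA _ (fun (c : C) (j : 'I_n.+2) => (k.+1 - mdeg (val c))%N)) /=.
  rewrite -(pair_bigA _ (fun (c : C) (i : 'I_n.+1) => (k.+1 - mdeg (val c) - e i)%N)) /=.
  rewrite addSn ltnS -big_split /=; apply: leq_sum => c _; rewrite sum_nat_const card_ord.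
  (* Tail by tail, [R_count] at k - mdeg c gives equality, and tails of degree above k carry no
     coefficients; the vector for m makes the total strict. *)
  have [ck|kc] := leqP (mdeg (val c)) k.
    have -> : (E - mdeg (val c) = d + (k - mdeg (val c)))%N by rewrite addnBA // -Ek.
    by rewrite subSn // -R_count addnC.
  have kE : (k.+1 - mdeg (val c) = 0)%N by lia.
  by rewrite kE muln0 leq0n.
pose V j := \sum_x gam x *: vec x j.
have V_homog j : V j \is k.-homog.
  by rewrite /V; apply: rpred_sum => x _; rewrite rpredZ.
have V0 j : V j = 0.
  apply/mpolyP => m'; rewrite mcoeff0.
  have [m'k|m'k] := eqVneq (mdeg m') k; last first.
    by apply: dhomog_nemf_coeff (V_homog j) m'k.
  have [ct cu m'E] := tail_mon_tail m'; rewrite m'k in cu m'E.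
  set c := (m' - first_two m')%MM in ct cu m'E.
  have cE : (mdeg c < E.+1)%N by rewrite Ek; lia.
  pose cC : C := exist (fun c : 'X_{1..n.+2 < E.+1} => is_tail (bmnm c)) (BMultinom cE) ct.
  have uc : (m' (lift ord0 ord0) < k.+1 - mdeg (bmnm (val (cC, j).1)))%N by rewrite /=; lia.
  have := sol (Tagged (fun p : C * 'I_n.+2 => 'I_(k.+1 - mdeg (bmnm (val p.1)))) (Ordinal uc)).
  rewrite /coord /= m'E => s0; rewrite -[RHS]s0 raddf_sum /=.
  by apply: eq_bigr => x _; rewrite mcoeffZ.
pose w (o : option T1) := \sum_j vec (inl o) j * F j.
pose mon (o : option T1) := if o is Some t then mon1 t else m.
(* Pairing V with F kills the syzygies and leaves a relation between forms with distinct leading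
   monomials. *)
have gam1 o : gam (inl o) = 0.
  apply: (@lead_independent _ _ _ w mon (fun o => gam (inl o))).
  - have Sinj t t' : mon1 t = mon1 t' -> t = t'.
      case: t t' => [c u] [c' u'] tt.
      have [/val_inj/val_inj cc uu] := tail_mon_inj (CT c) (CT c') tt.
      by subst c'; have -> : u = u' by apply: val_inj.
    (* The assumption on m enters here: in [mon1 t] the exponents of x_0 and x_1 add up to E - mdeg
       c, and that of x_1 is below R of this sum. *)
    have SN t : mon1 t <> m.
      move=> mE; case/negP: mR; rewrite -mE tail_mon_1 // tail_mon_0 // subnK ?ltn_ord //.
      by rewrite -ltnS (leq_trans (ltn_ord _)) ?R_le.
    by move=> [t|] [t'|] //= => [/Sinj ->|/SN|/esym/SN].
  - by case=> [t|] /=; [case: (A1P t) | exact: b_lead].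
  - transitivity (\sum_j V j * F j); last by apply: big1 => j _; rewrite V0 mul0r.
    rewrite /V; under [RHS]eq_bigr => j _ do rewrite mulr_suml.
    rewrite exchange_big big_sumType /= [X in _ + X]big1 ?addr0.
      apply: eq_bigr => o' _; rewrite /w scaler_sumr.
      by apply: eq_bigr => j _; rewrite scalerAl.
    move=> y _; under eq_bigr => j _ do rewrite -scalerAl -mulrA.
    by rewrite -scaler_sumr -mulr_sumr psiF mulr0 scaler0.
pose mon2' (y : T2) := tail_mon (val (tag y).1) (k - e (tag y).2) (tagged y).
pose B i := \sum_(y : T2 | (tag y).2 == i) gam (inr y) *: ('X_[mon2' y] : S).
(* What remains of V is a combination of syzygies, with coefficients collected in [B]. *)
have B0 : forall i, B i = 0.
  apply: psi_indep => j; rewrite -[RHS](V0 j) /V big_sumType /= [X in _ = X + _]big1 ?add0r; last first.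
    by move=> o _; rewrite gam1 scale0r.
  rewrite [RHS](partition_big (fun y : T2 => (tag y).2) predT) //=; apply: eq_bigr => i _.
  rewrite /B mulr_suml; apply: eq_bigr => y /eqP yi.
  by rewrite -yi -scalerAl.
case: x0 gam0 => [o|y]; first by rewrite gam1 eqxx.
move/eqP; apply; have := congr1 (mcoeff (mon2' y)) (B0 (tag y).2).
rewrite raddf_sum mcoeff0 (bigD1 y) //= mcoeffZ mcoeffX eqxx mulr1 big1 ?addr0 // => y'.
case/andP => yi yy; rewrite mcoeffZ mcoeffX; case: eqP => [mE|]; last by rewrite mulr0.
case/eqP: yy; move: mE yi; case: y => [[c i] u]; case: y' => [[c' i'] u'] mE /eqP /= ii.
have [/val_inj/val_inj cc uu] := tail_mon_inj (CT c') (CT c) mE.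
by subst c' i'; have -> : u = u' by apply: val_inj.
Qed.

End LeadCount.

(** * Equality of B with the initial ideal *)

Section InitialIdeal.
Context (K : fieldType) (charK : [pchar K] =i pred0) (n d : nat) (kap : 'I_d -> 'I_n.+1).
Local Notation S := {mpoly K[n.+2]}.
Local Notation e i := #|[pred m | kap m == i]|.
Local Notation A := (arr charK kap).
Local Notation f j := ((arr_poly A)^`M(j)).
Context (B : S -> Prop) (dmax : nat) (g : 'M[K]_n.+2).
Hypothesis Bs : strongly_stable B.
Hypothesis Bft : forall m, B 'X_[m] -> B 'X_[first_two m].
Hypothesis B_lt : forall t, (t < d)%N -> nrow B t = 0%N.
Hypothesis B_dmax : nrow B dmax = dmax.+1.
Hypothesis B_count : forall k, (\sum_i (k.+1 - e i) + nrow B (d + k) = n.+2 * k.+1)%N.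
Hypothesis gu : g \in unitmx.
Hypothesis g_leads : forall k, (k < (dmax - d).+1)%N -> plane_leads charK kap k (nrow B (d + k)) g.

Lemma linear_change_jacobianE h :
  linear_change_ideal g (jacobian_ideal A) h <->
  exists a : 'I_n.+2 -> S, h = \sum_j a j * linear_change g (f j).
Proof.
split=> [[h0 /jacobian_idealE[a ->] ->]|[a ->]].
  exists (fun j => linear_change g (a j)); rewrite rmorph_sum.
  by apply: eq_bigr => j _; rewrite rmorphM.
exists (\sum_j linear_change (invmx g) (a j) * f j); first by apply/jacobian_idealE; eexists.
rewrite rmorph_sum; apply: eq_bigr => j _.
by rewrite rmorphM /= linear_changeM mulmxV // linear_change1.
Qed.

(** Up to [dmax] this is genericity of g. Since the row at [dmax] is full, every later monomial in
    x_0, x_1 is a multiple of a leading monomial of degree [dmax]. *)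
Lemma row_leads t j : (j < nrow B t)%N ->
  exists a : 'I_n.+2 -> S, is_lead_monomial (\sum_i a i * linear_change g (f i)) (mon2 n (t - j) j).
Proof.
have low t' j' : (t' <= dmax)%N -> (j' < nrow B t')%N ->
    exists a : 'I_n.+2 -> S, is_lead_monomial (\sum_i a i * linear_change g (f i)) (mon2 n (t' - j') j').
  move=> t'd j't; have [t'lt|dt'] := ltnP t' d; first by rewrite B_lt in j't.
  have kT : (t' - d < (dmax - d).+1)%N by rewrite ltnS leq_sub2r.
  have := g_leads kT; rewrite /plane_leads subnKC // => /(_ _ j't)[h hJ hlead].
  have [|a E] := (linear_change_jacobianE (linear_change g h)).1; first by exists h.
  by exists a; rewrite -E.
move=> jt; have [|dt] := leqP t dmax; first by move/low; apply.
have jle : (j <= t)%N by rewrite -ltnS (leq_trans jt) ?nrow_le.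
have [|a a_lead] := low dmax (minn j dmax) (leqnn _); first by rewrite B_dmax ltnS geq_minr.
pose c := (mon2 n (t - j) j - mon2 n (dmax - minn j dmax) (minn j dmax))%MM.
exists (fun i => 'X_[c] * a i).
have := is_lead_mulX c a_lead; rewrite mulr_sumr submK; last by apply: mon2_le; lia.
by under eq_bigr => i _ do rewrite mulrA.
Qed.

(** [row_leads] gives one inclusion. For the other, [lead_in_rows] with the syzygies transported by
    g shows that the part of m in x_0 and x_1 already lies in B. *)
Lemma initial_idealE :
  eq_ideal B (initial_ideal (linear_change_ideal g (jacobian_ideal A))).
Proof.
have Bm := proj1 Bs; move=> h; split.
  move: h; apply: monomial_ideal_min => //; first exact: ideal_gen_ideal.
  move=> m Bx; set i := m ord0; set j := m (lift ord0 ord0).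
  have Bij : inB B i j by apply/asboolP; rewrite -first_two_mon2; apply: Bft.
  have jr : (j < nrow B (i + j))%N by rewrite -(nrowP Bs) ?leq_addl // addnK.
  have [a a_lead] := row_leads jr; rewrite addnK -first_two_mon2 in a_lead.
  have le_m : (first_two m <= m)%MM by apply/mnm_lepP => k; rewrite mnmE; case: ifP.
  rewrite -(submK le_m) mpolyXD.
  have [_ _ IM] : is_ideal (initial_ideal (linear_change_ideal g (jacobian_ideal A))).
    exact: ideal_gen_ideal.
  apply: IM; apply: ideal_of_gen.
  by exists (\sum_i a i * linear_change g (f i)), (first_two m); split=> //;
     apply/linear_change_jacobianE; exists a.
move: h; apply: ideal_gen_min; first exact: monomial_ideal_ideal.
move=> _ [h [m [/linear_change_jacobianE[a ->] a_lead ->]]].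
have : (m (lift ord0 ord0) < nrow B (m ord0 + m (lift ord0 ord0)))%N.
  apply: (@lead_in_rows K n d (fun j => linear_change g (f j))
    (fun i j => linear_change g (jac_syz K kap i j)) (fun i => e i) (nrow B)
    _ _ _ _ _ _ _ a m a_lead) => //.
  - by move=> j; apply/linear_change_homog/jac_homog.
  - by move=> i j; apply/linear_change_homog/jac_syz_homog.
  - move=> i; transitivity (linear_change g (\sum_j jac_syz K kap i j * f j)).
      by rewrite rmorph_sum; apply: eq_bigr => j _; rewrite rmorphM.
    by rewrite jac_syzP rmorph0.
  (* Independence survives the change of coordinates: the coefficients are pulled back by
     [invmx g]. *)
  - move=> b b0 i.
    have bi : linear_change (invmx g) (b i) = 0.
      apply: (jac_syz_indep charK (kap := kap) (b := fun i => linear_change (invmx g) (b i))) => j.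
      transitivity (linear_change (invmx g) (\sum_i b i * linear_change g (jac_syz K kap i j))).
        by rewrite rmorph_sum; apply: eq_bigr => i' _; rewrite rmorphM /= linear_changeK.
      by rewrite b0 rmorph0.
    by rewrite -[b i]linear_change1 -(mulmxV gu) -linear_changeM bi rmorph0.
  - exact: nrow_le.
  - exact: row_leads.
rewrite -(nrowP Bs) ?leq_addl // addnK => /asboolP Bij.
apply: monomial_ideal_le Bm Bij _; rewrite -first_two_mon2.
by apply/mnm_lepP => k; rewrite mnmE; case: ifP.
Qed.

End InitialIdeal.

Theorem theorem9p8 (K : fieldType) (l : nat) (B : {mpoly K[l]} -> Prop)
    (d_min d_max : nat) :
  [pchar K] =i pred0 ->
  strongly_stable B ->
  cohen_macaulay_quot B ->
  has_codim B 2 ->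
  (beta0 B d_min <> 0%N /\ forall j, beta0 B j <> 0%N -> (d_min <= j)%N) ->
  (beta0 B d_max <> 0%N /\ forall j, beta0 B j <> 0%N -> (j <= d_max)%N) ->
  beta0 B d_min = l ->
  (beta0 B d_min.+1 < beta0 B d_min)%N ->
  (forall j, (d_min < j)%N -> (j < d_max)%N ->
     (beta0 B j.+1 <= beta0 B j)%N) ->
  exists (n : nat) (A : arrangement K l n),
    [/\ free_arrangement A, is_rgin (jacobian_ideal A) B & n = d_min.+1].
Proof.
move=> charK Bs Bcm Bcod [_ beta_lt] [beta_max beta_gt] beta_d beta_d1 beta_noninc.
have [l2 [c Bc]] := codim2_powers Bs Bcod.
case: l l2 B Bs Bcm Bcod beta_lt beta_max beta_gt beta_d beta_d1 beta_noninc Bc => [|[|n]] // _ B.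
move=> Bs Bcm Bcod beta_lt beta_max beta_gt beta_d beta_d1 beta_noninc Bc.
have Bft m : B 'X_[m] -> B 'X_[first_two m] by apply: cm_codim2_first_two.
have [e [sum_e count]] := exists_exponents Bs Bft Bc beta_d beta_lt beta_max beta_gt beta_d1 beta_noninc.
have [kap kapE] := exists_coloring ord0 sum_e.
have {}count k : (\sum_i (k.+1 - #|[pred m | kap m == i]|) + nrow B (d_min + k) = n.+2 * k.+1)%N.
  by rewrite -count; congr addn; apply: eq_bigr => i _; rewrite kapE.
(* The degrees from d_min to d_max are the only ones that impose a condition on g, so finitely many
   suffice. *)
have [U [U_open U_ne U_leads]] := generic_plane_leads charK (d_max - d_min).+1
  (fun k => nrow_le B (d_min + k)) count.
exists d_min.+1, (arr charK kap); split=> //; first exact: arr_free.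
exists U; split=> // g /U_leads[gu g_leads].
apply: initial_idealE g_leads => //.
- exact: nrow_lt_d beta_lt.
- exact: (nrow_dmax Bs Bft Bc beta_d beta_lt beta_max beta_gt).
Qed.
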